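(* The satisfiability problem of $\mathrm{GRA}(p,s,I,\neg,J,\exists)$ is $\Pi_1^0$-complete.
   Context: AD-relations. $A^0=\{\epsilon\}$, with $\epsilon$ the empty tuple. A $k$-ary AD-relation over a set $A$ is a pair $(R,k)$ with $R\subseteq A^k$, $k\ge 0$; $t\in(R,k)$ means $t\in R$. Vocabularies contain only relation symbols (of any arity $k\ge 0$, countably infinitely many available for each arity). Models have nonempty (possibly infinite) domains; $A$ is the domain of $\mathfrak{A}$. Terms. $\mathrm{GRA}(p,s,I,\neg,J,\exists)$ is the set of terms built from relation symbols by the unary operators $p,s,I,\neg,\exists$ and the binary operator $J$. Each term $\mathcal{T}$ defines in each model $\mathfrak{A}$ an AD-relation $\mathcal{T}^{\mathfrak{A}}$ of arity $\mathit{ar}(\mathcal{T})$. Let $k=\mathit{ar}(\mathcal{T})$, $\ell=\mathit{ar}(\mathcal{S})$. - $R^{\mathfrak{A}}$ is the interpretation of $R$, paired with the arity of $R$. - If $k\ge2$: $(p\mathcal{T})^{\mathfrak{A}}=(\{(a_k,a_1,\dots,a_{k-1})\mid(a_1,\dots,a_k)\in\mathcal{T}^{\mathfrak{A}}\},k)$; $(s\mathcal{T})^{\mathfrak{A}}=(\{(a_1,\dots,a_{k-2},a_k,a_{k-1})\mid(a_1,\dots,a_k)\in\mathcal{T}^{\mathfrak{A}}\},k)$; $(I\mathcal{T})^{\mathfrak{A}}=(\{(a_1,\dots,a_{k-1})\mid(a_1,\dots,a_k)\in\mathcal{T}^{\mathfrak{A}},\ a_{k-1}=a_k\},k-1)$.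 If $k\le1$, each of $p\mathcal{T},s\mathcal{T},I\mathcal{T}$ is interpreted as $\mathcal{T}^{\mathfrak{A}}$. - $(\neg\mathcal{T})^{\mathfrak{A}}=(\{t\in A^k\mid t\notin\mathcal{T}^{\mathfrak{A}}\},k)$. - $(J(\mathcal{T},\mathcal{S}))^{\mathfrak{A}}=(\{(a_1,\dots,a_k,b_1,\dots,b_\ell)\mid(a_1,\dots,a_k)\in\mathcal{T}^{\mathfrak{A}},(b_1,\dots,b_\ell)\in\mathcal{S}^{\mathfrak{A}}\},k+\ell)$. - If $k\ge1$: $(\exists\mathcal{T})^{\mathfrak{A}}=(\{(a_1,\dots,a_{k-1})\mid(a_1,\dots,a_k)\in\mathcal{T}^{\mathfrak{A}}\text{ for some }a_k\in A\},k-1)$; if $k=0$: $(\exists\mathcal{T})^{\mathfrak{A}}=\mathcal{T}^{\mathfrak{A}}$. Satisfiability problem for a set $\mathcal{G}$ of terms: on input $\mathcal{T}\in\mathcal{G}$, answer yes iff there exists a model $\mathfrak{A}$ such that $\mathcal{T}^{\mathfrak{A}}$ is not the empty AD-relation $(\varnothing,\mathit{ar}(\mathcal{T}))$. *)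

(* Defs.v *)
From Stdlib Require Cantor.
From mathcomp Require Import all_boot.
Set Implicit Arguments.
Unset Strict Implicit.
Unset Printing Implicit Defensive.

(* The relation symbols are the pairs [(k, i)], with [k] the arity. *)
Inductive term : Type :=
| Rel (k i : nat)
| Tp (T : term)
| Ts (T : term)
| TI (T : term)
| Tneg (T : term)
| TJ (T U : term)
| Tex (T : term).

Definition arI (k : nat) : nat := if k is _.+2 then k.-1 else k.

Fixpoint ar (T : term) : nat :=
  match T with
  | Rel k _ => k
  | Tp T | Ts T | Tneg T => ar T
  | TI T => arI (ar T)
  | TJ T U => ar T + ar U
  | Tex T => (ar T).-1
  end.

(* The AD-relation (R, k) over A is [R : ADrel A k]: the arity is part of the
   type, so that there is a distinct empty AD-relation for every arity. *)
Definition ADrel (A : Type) (k : nat) : Type := k.-tuple A -> Prop.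

Section Operators.
Variable A : Type.

(* [rotr 1] maps (a_1, ..., a_k) to (a_k, a_1, ..., a_{k-1}). *)
Definition ad_p (k : nat) : ADrel A k -> ADrel A k :=
  if k is _.+2 then fun R t => exists2 u, R u & tval t = rotr 1 u
  else fun R => R.

Definition ad_s (k : nat) : ADrel A k -> ADrel A k :=
  if k is _.+2 then fun R t => exists2 u, R u &
    exists (w : seq A) (a b : A),
      tval u = w ++ [:: a; b] /\ tval t = w ++ [:: b; a]
  else fun R => R.

Definition ad_I (k : nat) : ADrel A k -> ADrel A (arI k) :=
  match k return ADrel A k -> ADrel A (arI k) with
  | _.+2 => fun R t => exists2 u, R u &
      exists (w : seq A) (a : A),
        tval u = w ++ [:: a; a] /\ tval t = w ++ [:: a]
  | _ => fun R => R
  end.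

Definition ad_neg (k : nat) (R : ADrel A k) : ADrel A k := fun t => ~ R t.

Definition ad_J (k l : nat) (R : ADrel A k) (Q : ADrel A l) : ADrel A (k + l) :=
  fun t => exists u v, [/\ R u, Q v & t = [tuple of u ++ v]].

Definition ad_ex (k : nat) : ADrel A k -> ADrel A k.-1 :=
  match k return ADrel A k -> ADrel A k.-1 with
  | _.+1 => fun R t => exists2 u, R u & exists a : A, tval u = rcons t a
  | 0 => fun R => R
  end.

End Operators.

Record model : Type := Model {
  dom : Type;
  dom_nonempty : inhabited dom;
  interp : forall k : nat, nat -> ADrel dom k
}.

Fixpoint sem (M : model) (T : term) : ADrel (dom M) (ar T) :=
  match T return ADrel (dom M) (ar T) with
  | Rel k i => @interp M k i
  | Tp T => ad_p (@sem M T)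
  | Ts T => ad_s (@sem M T)
  | TI T => ad_I (@sem M T)
  | Tneg T => ad_neg (@sem M T)
  | TJ T U => ad_J (@sem M T) (@sem M U)
  | Tex T => ad_ex (@sem M T)
  end.

Arguments sem M T _ : clear implicits.

Definition satisfiable (T : term) : Prop :=
  exists (M : model) (t : (ar T).-tuple (dom M)), sem M T t.

Inductive recfun : nat -> Type :=
| rec_zero k : recfun k
| rec_succ : recfun 1
| rec_proj k (i : 'I_k) : recfun k
| rec_comp k m (f : recfun m) (g : 'I_m -> recfun k) : recfun k
| rec_prim k (f : recfun k) (g : recfun k.+2) : recfun k.+1
| rec_mu k (f : recfun k.+1) : recfun k.

(* [rec_eval f v y]: the partial function denoted by [f] is defined at [v],
   with value [y]. Primitive recursion is on the first argument [n], through
   the equations h(0, u) = f(u) and h(i+1, u) = g(i, h(i, u), u); the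
   unbounded search also runs over the first argument. *)
Fixpoint rec_eval (k : nat) (f : recfun k) : k.-tuple nat -> nat -> Prop :=
  match f in recfun k return k.-tuple nat -> nat -> Prop with
  | rec_zero _ => fun _ y => y = 0
  | rec_succ => fun v y => y = (thead v).+1
  | rec_proj _ i => fun v y => y = tnth v i
  | rec_comp _ m f g => fun v y =>
      exists2 w : m.-tuple nat,
        forall i, rec_eval (g i) v (tnth w i) & rec_eval f w y
  | rec_prim _ f g => fun v y =>
      let n := thead v in
      let u := [tuple of behead v] in
      exists h : nat -> nat,
        [/\ rec_eval f u (h 0),
            forall i, i < n -> rec_eval g [tuple of i :: h i :: u] (h i.+1)
          & y = h n]
  | rec_mu _ f => fun v y =>
      rec_eval f [tuple of y :: v] 0 /\
      forall i, i < y -> exists z, rec_eval f [tuple of i :: v] z.+1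
  end.

Definition total_recursive (k : nat) (f : k.-tuple nat -> nat) : Prop :=
  exists c : recfun k, forall v y, rec_eval c v y <-> y = f v.

Definition recursive_rel (R : rel nat) : Prop :=
  total_recursive (fun v : 2.-tuple nat =>
    nat_of_bool (R (tnth v ord0) (tnth v ord_max))).

Definition Pi01 (X : nat -> Prop) : Prop :=
  exists2 R : rel nat, recursive_rel R &
    forall x, X x <-> (forall y, R x y).

Definition many_one_reducible (X Y : nat -> Prop) : Prop :=
  exists2 f : nat -> nat,
    total_recursive (fun v : 1.-tuple nat => f (thead v)) &
    forall x, X x <-> Y (f x).

Definition Pi01_complete (X : nat -> Prop) : Prop :=
  Pi01 X /\ forall Y, Pi01 Y -> many_one_reducible Y X.

Definition npair (a b : nat) : nat := Cantor.to_nat (a, b).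

Fixpoint code (T : term) : nat :=
  match T with
  | Rel k i => npair 0 (npair k i)
  | Tp T => npair 1 (code T)
  | Ts T => npair 2 (code T)
  | TI T => npair 3 (code T)
  | Tneg T => npair 4 (code T)
  | TJ T U => npair 5 (npair (code T) (code U))
  | Tex T => npair 6 (code T)
  end.

Lemma npair_inj a b c d : npair a b = npair c d -> a = c /\ b = d.
Proof. by move/Cantor.to_nat_inj => -[-> ->]. Qed.

Lemma code_inj : injective code.
Proof.
elim=> [k i|T IH|T IH|T IH|T IH|T IHT U IHU|T IH]
       [k' i'|T'|T'|T'|T'|T' U'|T'] //=; move/npair_inj=> [// _].
- by move/npair_inj=> [-> ->].
- by move/IH->.
- by move/IH->.
- by move/IH->.
- by move/IH->.
- by move/npair_inj=> [/IHT-> /IHU->].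
- by move/IH->.
Qed.

Definition sat_problem (n : nat) : Prop :=
  exists2 T : term, code T = n & satisfiable T.

(* Main.v *)
(** Membership: a term is satisfiable iff its existential closure is true in some
    Hintikka assignment, that is, a truth assignment to all pairs of a term and
    a list of numbers that obeys the truth conditions of the operators and in
    which the pair of [T] and [l] itself, as a number, witnesses the quantifier
    of [Tex T] at [l]. All the conditions are universal and local, so by
    compactness such an assignment exists iff each finite part of the conditions
    is met by a finite assignment, which is a decidable property.

    Hardness: the graph of a recursive function is the least model of a finite
    Horn theory. Every model of this theory satisfies the true values of the
    function, and the standard model satisfies no others, so the theory is
    consistent with the absence of a [y] with [c(x, y) = 0] iff there is indeed no
    such [y]. Equality and the uniqueness of zero and successors are not needed. *)

Require Import Defs.
From Stdlib Require Import Classical ClassicalEpsilon.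
From Stdlib Require Cantor.
From mathcomp Require Import all_boot.
From mathcomp Require Import zify.
Set Implicit Arguments.
Unset Strict Implicit.
Unset Printing Implicit Defensive.

(** * Recursive functions *)

(** Naming the witness of a quantifier by the number [npair u l] removes the alternation from the
    quantifier condition. In a given model such names can be interpreted because the entries of a
    list are smaller than its code, so that the named elements are chosen by recursion. Conversely,
    the numbers themselves form the domain of the model read off an assignment, so each witness is
    an element. In the hardness part the obstacle is the absence of variables. A clause is built by
    laying out the arguments of all its atoms in separate places with [J] and then identifying these
    places with variables by rotations and [I]. The existence of a zero and of successors is not a
    Horn condition and is added separately. The input [x] enters as a chain of [x] successors below
    a negation: in an arbitrary model one such chain suffices for a contradiction, and the standard
    model has only one. *)

Lemma total_recursive_ext k (f g : k.-tuple nat -> nat) :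
  f =1 g -> total_recursive f -> total_recursive g.
Proof. by move=> fg [c cP]; exists c => v y; rewrite cP fg. Qed.

Lemma total_recursive_comp k m (f : m.-tuple nat -> nat)
    (g : 'I_m -> k.-tuple nat -> nat) :
  total_recursive f -> (forall i, total_recursive (g i)) ->
  total_recursive (fun v => f [tuple g i v | i < m]).
Proof.
move=> [cf fP] /fin_all_exists[cg gP]; exists (rec_comp cf cg) => v y /=.
split=> [[w wP /fP->]|->].
  congr (f _); apply: eq_from_tnth => i; rewrite tnth_mktuple.
  exact/gP/wP.
exists [tuple g i v | i < m]; last exact/fP.
by move=> i; rewrite tnth_mktuple; apply/gP.
Qed.

Lemma total_recursive_prim k (f : k.-tuple nat -> nat)
    (g : k.+2.-tuple nat -> nat) :
  total_recursive f -> total_recursive g ->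
  total_recursive (fun v : k.+1.-tuple nat =>
    nat_rect (fun _ => nat) (f [tuple of behead v])
      (fun i h => g [tuple of i :: h :: behead v]) (thead v)).
Proof.
move=> [cf fP] [cg gP]; exists (rec_prim cf cg) => v y /=.
set h0 := nat_rect _ _ _.
split=> [[h [/fP h0P hP ->]]|->].
  (* Only the values of [h] up to the bound are constrained, so one occurrence of [thead v] stays
     fixed as the bound. *)
  have: thead v <= thead v by [].
  elim: {1 3 4}(thead v) => [|i IH] lt_i //=.
  by move/gP: (hP i lt_i) => ->; rewrite IH // ltnW.
exists h0; split=> //; first exact/fP.
by move=> i _; apply/gP.
Qed.

Lemma total_recursive_const k n : total_recursive (fun _ : k.-tuple nat => n).
Proof.
elim: n => [|n IH]; first by exists (rec_zero k).
apply: (total_recursive_ext (f := fun v : k.-tuple nat =>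
   (thead [tuple n | i < 1]).+1)) => [v|]; first by rewrite /thead tnth_mktuple.
apply: (@total_recursive_comp k 1 (fun v => (thead v).+1) (fun _ _ => n)) => //.
by exists rec_succ.
Qed.

Lemma total_recursive_nth k i : total_recursive (fun v : k.-tuple nat => nth 0 v i).
Proof.
case: (ltnP i k) => [lt_ik|le_ki].
  exists (rec_proj (Ordinal lt_ik)) => v y /=.
  by rewrite (tnth_nth 0).
apply: total_recursive_ext (total_recursive_const k 0) => v.
by rewrite nth_default // size_tuple.
Qed.

Definition crec (f : nat -> nat) :=
  total_recursive (fun v : 1.-tuple nat => f (nth 0 v 0)).
Definition rec2 (f : nat -> nat -> nat) :=
  total_recursive (fun v : 2.-tuple nat => f (nth 0 v 0) (nth 0 v 1)).
Definition rec3 (f : nat -> nat -> nat -> nat) :=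
  total_recursive (fun v : 3.-tuple nat => f (nth 0 v 0) (nth 0 v 1) (nth 0 v 2)).

Section Application.
Variable k : nat.
Implicit Types a b : k.-tuple nat -> nat.

Lemma total_recursive_app1 f a :
  crec f -> total_recursive a -> total_recursive (fun v => f (a v)).
Proof.
move=> fP aP.
apply: total_recursive_ext (total_recursive_comp (g := fun _ => a) fP _) => // v.
by rewrite (nth_mktuple _ _ ord0).
Qed.

Lemma total_recursive_app2 f a b :
  rec2 f -> total_recursive a -> total_recursive b ->
  total_recursive (fun v => f (a v) (b v)).
Proof.
move=> fP aP bP.
apply: total_recursive_ext
  (total_recursive_comp (g := fun i => nth a [:: a; b] i) fP _) => [v|].
  by rewrite (nth_mktuple _ _ (Ordinal (isT : 0 < 2)))
             (nth_mktuple _ _ (Ordinal (isT : 1 < 2))).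
by case=> [[|[|]]].
Qed.

End Application.

Lemma crec_comp f g : crec f -> crec g -> crec (fun x => f (g x)).
Proof. exact: total_recursive_app1. Qed.

Lemma crec_succ : crec S.
Proof. by exists rec_succ => v y /=; rewrite /thead (tnth_nth 0). Qed.

Lemma crec_nat_rect n g : rec2 g -> crec (nat_rect (fun _ => nat) n g).
Proof.
move=> gP; apply: total_recursive_ext
  (total_recursive_prim (total_recursive_const 0 n) gP) => v /=.
by rewrite /thead (tnth_nth 0).
Qed.

Lemma rec2_nat_rect f g : crec f -> rec3 g ->
  rec2 (fun n x => nat_rect (fun _ => nat) (f x) (fun i h => g i h x) n).
Proof.
move=> fP gP; apply: total_recursive_ext (total_recursive_prim fP gP) => v.
rewrite /thead (tnth_nth 0) /=; case: v => [] [|n [|x [|]]] //=.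
Qed.

Lemma rec2_swap f : rec2 f -> rec2 (fun x y => f y x).
Proof. by move=> fP; apply: total_recursive_app2 fP _ _; apply: total_recursive_nth. Qed.

Lemma rec2_add : rec2 addn.
Proof.
have fP : crec id by apply: total_recursive_nth.
have gP : rec3 (fun _ h _ => h.+1).
  by apply: total_recursive_app1 crec_succ _; apply: total_recursive_nth.
apply: total_recursive_ext (rec2_nat_rect fP gP) => v /=.
by elim: (nth 0 v 0) => //= n ->; rewrite addSn.
Qed.

Lemma crec_pred : crec predn.
Proof.
have gP : rec2 (fun i _ => i) by apply: total_recursive_nth.
by apply: total_recursive_ext (crec_nat_rect 0 gP) => v /=; case: (nth 0 v 0).
Qed.

Lemma rec2_sub : rec2 subn.
Proof.
apply: rec2_swap.
have fP : crec id by apply: total_recursive_nth.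
have gP : rec3 (fun _ h _ => h.-1).
  by apply: total_recursive_app1 crec_pred _; apply: total_recursive_nth.
have E n x : nat_rect (fun _ => nat) x (fun _ h => h.-1) n = x - n.
  by elim: n => [|n /= ->]; rewrite ?subn0 ?subnS.
by apply: total_recursive_ext (rec2_nat_rect fP gP) => v; apply: E.
Qed.

(** * The Cantor pairing and its inverses are recursive *)

Definition triangle (n : nat) : nat :=
  nat_rect (fun _ => nat) 0 (fun i m => i.+1 + m) n.

(** [triangle] copies the recursion inside [Cantor.to_nat], so this holds by conversion. *)
Lemma npairE a b : npair a b = b + triangle (b + a).
Proof. by []. Qed.

Lemma leq_triangle n : n <= triangle n.
Proof. by case: n => //= n; apply: leq_addr. Qed.

Lemma triangle_leq m n : m <= n -> triangle m <= triangle n.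
Proof.
elim: n => [|n IH]; first by rewrite leqn0 => /eqP->.
rewrite leq_eqVlt => /predU1P[->//|le_mn] /=.
by apply: leq_trans (IH le_mn) _; apply: leq_addl.
Qed.

Lemma crec_triangle : crec triangle.
Proof.
apply: crec_nat_rect; apply: total_recursive_app2 rec2_add _ _.
  exact: total_recursive_app1 crec_succ (total_recursive_nth _ _).
exact: total_recursive_nth.
Qed.

Definition pi1 (n : nat) := (Cantor.of_nat n).1.
Definition pi2 (n : nat) := (Cantor.of_nat n).2.

Lemma pi1P a b : pi1 (npair a b) = a.
Proof. by rewrite /pi1 Cantor.cancel_of_to. Qed.
Lemma pi2P a b : pi2 (npair a b) = b.
Proof. by rewrite /pi2 Cantor.cancel_of_to. Qed.
Lemma npairK n : npair (pi1 n) (pi2 n) = n.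
Proof. by rewrite /npair /pi1 /pi2 -surjective_pairing Cantor.cancel_to_of. Qed.

Lemma npair_ltn a b n : a < n -> b < n -> npair a b < npair n n.
Proof.
move=> an bn; rewrite !npairE -addSn leq_add // triangle_leq // leq_add //.
  exact: ltnW.
exact: ltnW.
Qed.

Lemma leq_npair1 a b : a <= npair a b.
Proof. by rewrite npairE; have := leq_triangle (b + a); lia. Qed.
Lemma leq_npair2 a b : b <= npair a b.
Proof. by rewrite npairE; lia. Qed.
Lemma ltn_npair2 a b : 0 < a -> b < npair a b.
Proof. by rewrite npairE; have := leq_triangle (b + a); lia. Qed.

(* The index of the antidiagonal of [npair] on which [n] lies. *)
Definition diagonal (n : nat) : nat :=
  nat_rect (fun _ => nat) 0 (fun i h => h + (1 - (triangle h.+1 - i.+1))) n.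

(** Truncated subtraction acts as a test: the recursion adds 1 exactly when the next triangular
    number is reached. *)
Lemma diagonalP n : triangle (diagonal n) <= n < triangle (diagonal n).+1.
Proof.
elim: n => //= n; rewrite -/(diagonal n); move: (diagonal n) => d.
rewrite /= => /andP[le1 lt2].
case: (leqP (d.+1 + triangle d) n.+1) => cmp.
  have E : d.+1 + triangle d = n.+1 by lia.
  by rewrite E subnn subn0 addn1 /=; lia.
rewrite (_ : 1 - _ = 0) ?addn0; lia.
Qed.

Lemma diagonalE n : diagonal n = pi2 n + pi1 n.
Proof.
rewrite -{1}(npairK n); move: (pi1 n) (pi2 n) => a b.
have := diagonalP (npair a b); rewrite {2 3}npairE.
set d := diagonal _; case/andP=> le1 lt2.
case: (ltngtP d (b + a)) => // cmp.
  by have := triangle_leq cmp; lia.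
by have := triangle_leq cmp => /=; lia.
Qed.

Lemma crec_diagonal : crec diagonal.
Proof.
apply: crec_nat_rect; apply: total_recursive_app2 rec2_add _ _.
  exact: total_recursive_nth.
apply: total_recursive_app2 rec2_sub _ _; first exact: total_recursive_const.
apply: total_recursive_app2 rec2_sub _ _.
  apply: total_recursive_app1 crec_triangle _.
  exact: total_recursive_app1 crec_succ (total_recursive_nth _ _).
exact: total_recursive_app1 crec_succ (total_recursive_nth _ _).
Qed.

Lemma crec_npair2 : rec2 npair.
Proof.
apply: total_recursive_app2 rec2_add _ _; first exact: total_recursive_nth.
apply: total_recursive_app1 crec_triangle _.
by apply: total_recursive_app2 rec2_add _ _; apply: total_recursive_nth.
Qed.

Lemma crec_pi2 : crec pi2.
Proof.
have E n : n - triangle (diagonal n) = pi2 n.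
  by rewrite diagonalE -{1}(npairK n) npairE addnK.
apply: total_recursive_ext (_ : crec (fun n => n - triangle (diagonal n))).
  by move=> v /=; rewrite E.
apply: total_recursive_app2 rec2_sub (total_recursive_nth _ _) _.
exact: total_recursive_app1 crec_triangle crec_diagonal.
Qed.

Lemma crec_pi1 : crec pi1.
Proof.
apply: total_recursive_ext (_ : crec (fun n => diagonal n - pi2 n)).
  by move=> v /=; rewrite diagonalE addKn.
exact: total_recursive_app2 rec2_sub crec_diagonal crec_pi2.
Qed.

(** * Closure properties of unary recursive functions *)

Lemma crec_id : crec (fun x => x).
Proof. exact: total_recursive_nth. Qed.

Lemma crec_const n : crec (fun _ => n).
Proof. exact: total_recursive_const. Qed.

Lemma crec_ext f g : f =1 g -> crec f -> crec g.
Proof. by move=> fg; apply: total_recursive_ext => v; apply: fg. Qed.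

Lemma crec_app2 f a b : rec2 f -> crec a -> crec b -> crec (fun x => f (a x) (b x)).
Proof. exact: total_recursive_app2. Qed.

(** Packing both arguments into one number lets recursiveness be proved by closure lemmas on unary
    functions, which follow the syntax of the body. *)
Lemma rec2_crec f : crec (fun p => f (pi1 p) (pi2 p)) -> rec2 f.
Proof.
move=> fP; apply: (total_recursive_ext (f := fun v : 2.-tuple nat =>
   f (pi1 (npair (nth 0 v 0) (nth 0 v 1))) (pi2 (npair (nth 0 v 0) (nth 0 v 1))))).
  by move=> v; rewrite pi1P pi2P.
apply: (total_recursive_app1 fP); apply: (total_recursive_app2 crec_npair2);
  exact: total_recursive_nth.
Qed.

Lemma crec_npair a b : crec a -> crec b -> crec (fun x => npair (a x) (b x)).
Proof. exact: crec_app2 crec_npair2. Qed.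
Lemma crec_add a b : crec a -> crec b -> crec (fun x => a x + b x).
Proof. exact: crec_app2 rec2_add. Qed.
Lemma crec_sub a b : crec a -> crec b -> crec (fun x => a x - b x).
Proof. exact: crec_app2 rec2_sub. Qed.
Lemma crec_S a : crec a -> crec (fun x => (a x).+1).
Proof. exact: crec_comp crec_succ. Qed.
Lemma crec_predn a : crec a -> crec (fun x => (a x).-1).
Proof. exact: crec_comp crec_pred. Qed.
Lemma crec_fst a : crec a -> crec (fun x => pi1 (a x)).
Proof. exact: crec_comp crec_pi1. Qed.
Lemma crec_snd a : crec a -> crec (fun x => pi2 (a x)).
Proof. exact: crec_comp crec_pi2. Qed.

Lemma crec_rect f n g : crec f -> crec n ->
  crec (fun p => g (pi1 p) (pi1 (pi2 p)) (pi2 (pi2 p))) ->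
  crec (fun x => nat_rect (fun _ => nat) (f x) (g x) (n x)).
Proof.
move=> fP nP gP.
suff gP3 : rec3 (fun i h x => g x i h).
  exact: (crec_app2 (rec2_nat_rect fP gP3) nP crec_id).
apply: (total_recursive_ext (f := fun v : 3.-tuple nat =>
  let p := npair (nth 0 v 2) (npair (nth 0 v 0) (nth 0 v 1)) in
  g (pi1 p) (pi1 (pi2 p)) (pi2 (pi2 p)))) => [v /=|]; first by rewrite !(pi1P, pi2P).
apply: (total_recursive_app1 gP); apply: (total_recursive_app2 crec_npair2).
  exact: total_recursive_nth.
by apply: (total_recursive_app2 crec_npair2); apply: total_recursive_nth.
Qed.

Lemma crec_iter n g f : crec n -> crec f ->
  crec (fun p => g (pi1 p) (pi2 p)) -> crec (fun x => iter (n x) (g x) (f x)).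
Proof.
move=> nP fP gP.
apply: (crec_ext (f := fun x => nat_rect (fun _ => nat) (f x) (fun _ h => g x h) (n x))).
  by move=> x; elim: (n x) => //= m ->.
apply: crec_rect => //.
apply: (crec_ext (f := fun p => g (pi1 (npair (pi1 p) (pi2 (pi2 p))))
                                  (pi2 (npair (pi1 p) (pi2 (pi2 p)))))).
  by move=> p; rewrite pi1P pi2P.
apply: (crec_comp gP); apply: crec_npair; first exact: crec_pi1.
exact: crec_snd crec_pi2.
Qed.

(** A truth value is the number 0 or 1, so a primitive recursion of that length selects the
    branch. *)
Lemma crec_if (P : nat -> bool) a b : crec P -> crec a -> crec b ->
  crec (fun x => if P x then a x else b x).
Proof.
move=> PP aP bP.
apply: (crec_ext (f := fun x => nat_rect (fun _ => nat) (b x) (fun _ _ => a x) (P x))).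
  by move=> x; case: (P x).
by apply: crec_rect => //; apply: (crec_comp aP); apply: crec_pi1.
Qed.

Lemma crec_negb (P : nat -> bool) : crec P -> crec (fun x => ~~ P x).
Proof.
move=> PP; apply: (crec_ext (f := fun x => 1 - P x)) => [x|]; first by case: (P x).
exact: crec_sub (crec_const 1) PP.
Qed.
Lemma crec_andb (P Q : nat -> bool) : crec P -> crec Q -> crec (fun x => P x && Q x).
Proof.
move=> PP QP; apply: (crec_ext (f := fun x => if P x then nat_of_bool (Q x) else 0)).
  by move=> x; case: (P x).
exact: crec_if PP QP (crec_const 0).
Qed.
Lemma crec_implb (P Q : nat -> bool) : crec P -> crec Q -> crec (fun x => P x ==> Q x).
Proof.
move=> PP QP; apply: (crec_ext (f := fun x => if P x then nat_of_bool (Q x) else 1)).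
  by move=> x; case: (P x).
exact: crec_if PP QP (crec_const 1).
Qed.

Lemma crec_leq a b : crec a -> crec b -> crec (fun x => a x <= b x).
Proof.
move=> aP bP; apply: (crec_ext (f := fun x => 1 - (a x - b x))).
  by move=> x; case: leqP; lia.
exact: crec_sub (crec_const 1) (crec_sub aP bP).
Qed.
Lemma crec_eq a b : crec a -> crec b -> crec (fun x => a x == b x).
Proof.
move=> aP bP; apply: (crec_ext (f := fun x => (a x <= b x) && (b x <= a x))).
  by move=> x; rewrite eqn_leq.
by apply: crec_andb; apply: crec_leq.
Qed.
Lemma crec_eqb (P Q : nat -> bool) : crec P -> crec Q -> crec (fun x => P x == Q x).
Proof.
move=> PP QP; apply: (crec_ext (f := fun x => nat_of_bool (P x) == nat_of_bool (Q x))).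
  by move=> x; case: (P x); case: (Q x).
exact: crec_eq.
Qed.

Lemma crec_all n (P : nat -> nat -> bool) : crec n ->
  crec (fun p => P (pi1 p) (pi2 p)) -> crec (fun x => all (P x) (iota 0 (n x))).
Proof.
move=> nP PP.
apply: (crec_ext (f := fun x =>
  nat_rect (fun _ => nat) 1 (fun i h => (h == 1) && P x i) (n x))).
  move=> x; elim: (n x) => // m IH.
  have -> : iota 0 m.+1 = rcons (iota 0 m) m by rewrite -(addn1 m) iotaD cats1.
  by rewrite all_rcons /= IH eqb1 andbC.
apply: crec_rect => //; first exact: crec_const.
apply: crec_andb.
  by apply: crec_eq (crec_const 1); exact: crec_snd crec_pi2.
apply: (crec_ext (f := fun p => P (pi1 (npair (pi1 p) (pi1 (pi2 p))))
                                  (pi2 (npair (pi1 p) (pi1 (pi2 p)))))).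
  by move=> p; rewrite pi1P pi2P.
apply: (crec_comp PP); apply: crec_npair; first exact: crec_pi1.
exact: crec_fst crec_pi2.
Qed.

Lemma crec_has n (P : nat -> nat -> bool) : crec n ->
  crec (fun p => P (pi1 p) (pi2 p)) -> crec (fun x => has (P x) (iota 0 (n x))).
Proof.
move=> nP PP; apply: (crec_ext (f := fun x => ~~ all (predC (P x)) (iota 0 (n x)))).
  by move=> x; rewrite -has_predC; congr nat_of_bool; apply: eq_has => i /=; rewrite negbK.
by apply: crec_negb; apply: crec_all => //; apply: crec_negb.
Qed.

Lemma crec_odd a : crec a -> crec (fun x => odd (a x)).
Proof.
move=> aP; apply: (crec_comp (f := odd)) aP.
apply: (crec_ext (f := nat_rect (fun _ => nat) 0 (fun _ h => 1 - h))).
  by elim=> //= n ->; case: odd.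
by apply: (crec_rect (g := fun _ _ h => 1 - h)); [exact: crec_const|exact: crec_id|];
  apply: crec_sub (crec_const 1) (crec_snd crec_pi2).
Qed.

Lemma crec_half a : crec a -> crec (fun x => (a x)./2).
Proof.
move=> aP; apply: (crec_comp (f := half)) aP.
apply: (crec_ext (f := nat_rect (fun _ => nat) 0 (fun i h => odd i + h))).
  by elim=> //= n ->; rewrite uphalf_half.
apply: (crec_rect (g := fun _ i h => odd i + h)); [exact: crec_const|exact: crec_id|].
by apply: crec_add (crec_snd crec_pi2); apply: crec_odd; apply: crec_fst crec_pi2.
Qed.

Lemma crec_exp2 a : crec a -> crec (fun x => 2 ^ a x).
Proof.
move=> aP; apply: (crec_ext (f := fun x => iter (a x) (fun h => h + h) 1)).
  by move=> x; elim: (a x) => //= n ->; rewrite expnS; lia.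
apply: crec_iter aP (crec_const 1) _.
by apply: crec_add; apply: crec_pi2.
Qed.

(** * Course-of-values recursion *)

Definition consc a l := (npair a l).+1.
Definition hdc l := pi1 l.-1.
Definition tlc l := pi2 l.-1.

Lemma hdcE a l : hdc (consc a l) = a. Proof. exact: pi1P. Qed.
Lemma tlcE a l : tlc (consc a l) = l. Proof. exact: pi2P. Qed.
Lemma conscK n : consc (pi1 n) (pi2 n) = n.+1. Proof. by rewrite /consc npairK. Qed.

(** The values are stored latest first; hence the one at [i] lies behind n - (i+1) other entries in
    [lookup]. *)
Definition table (f : nat -> nat) n := nat_rect (fun _ => nat) 0 (fun i => consc (f i)) n.
Definition lookup t n i := hdc (iter (n - i.+1) tlc t).

Lemma lookupE f n i : i < n -> lookup (table f n) n i = f i.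
Proof.
rewrite /lookup; elim: n => // n IH; rewrite ltnS leq_eqVlt => /predU1P[->|lt_in].
  by rewrite subnn /= hdcE.
by rewrite subSn // iterSr /= tlcE IH.
Qed.

Lemma crec_consc a b : crec a -> crec b -> crec (fun x => consc (a x) (b x)).
Proof. by move=> aP bP; apply: crec_S; apply: crec_npair. Qed.
Lemma crec_hdc a : crec a -> crec (fun x => hdc (a x)).
Proof. by move=> aP; apply: crec_fst; apply: crec_predn. Qed.
Lemma crec_tlc a : crec a -> crec (fun x => tlc (a x)).
Proof. by move=> aP; apply: crec_snd; apply: crec_predn. Qed.

Lemma crec_lookup a b c : crec a -> crec b -> crec c ->
  crec (fun x => lookup (a x) (b x) (c x)).
Proof.
move=> aP bP cP; apply: crec_hdc.
apply: crec_iter => //; first by apply: crec_sub => //; apply: crec_S.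
exact: crec_tlc crec_pi2.
Qed.

(** The table, unlike [f], obeys an ordinary primitive recursion, and [f] is then one application of
    [G] to it. *)
Lemma rec2_course_of_values (f : nat -> nat -> nat) G :
  crec (fun p => G (pi1 p) (pi1 (pi2 p)) (pi2 (pi2 p))) ->
  (forall x n, f x n = G x n (table (f x) n)) -> rec2 f.
Proof.
move=> GP fE; apply: rec2_crec.
have tabE x n : table (f x) n = nat_rect (fun _ => nat) 0 (fun i t => consc (G x i t) t) n.
  by elim: n => //= n IH; rewrite fE {2}IH -IH.
have tabP : crec (fun p => table (f (pi1 p)) (pi2 p)).
  apply: (crec_ext (f := fun p => nat_rect (fun _ => nat) 0
     (fun i t => consc (G (pi1 p) i t) t) (pi2 p))) => [p|]; first by rewrite tabE.
  apply: (crec_rect (g := fun p i t => consc (G (pi1 p) i t) t));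
    [exact: crec_const|exact: crec_pi2|].
  apply: crec_consc (crec_snd crec_pi2).
  pose q p := npair (pi1 (pi1 p)) (pi2 p).
  apply: (crec_ext (f := fun p => G (pi1 (q p)) (pi1 (pi2 (q p))) (pi2 (pi2 (q p))))).
    by move=> p; rewrite !(pi1P, pi2P).
  by apply: (crec_comp GP); apply: crec_npair crec_pi2; apply: crec_fst crec_pi1.
pose q p := npair (pi1 p) (npair (pi2 p) (table (f (pi1 p)) (pi2 p))).
apply: (crec_ext (f := fun p => G (pi1 (q p)) (pi1 (pi2 (q p))) (pi2 (pi2 (q p))))).
  by move=> p; rewrite !(pi1P, pi2P) -fE.
apply: (crec_comp GP); apply: crec_npair; first exact: crec_pi1.
exact: crec_npair crec_pi2 tabP.
Qed.

Ltac crec_step :=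
  lazymatch goal with
  | |- crec (fun x => x) => exact: crec_id
  | |- crec pi1 => exact: crec_pi1
  | |- crec pi2 => exact: crec_pi2
  | |- crec (fun x => npair _ _) => apply: crec_npair
  | |- crec (fun x => consc _ _) => apply: crec_consc
  | |- crec (fun x => hdc _) => apply: crec_hdc
  | |- crec (fun x => tlc _) => apply: crec_tlc
  | |- crec (fun x => lookup _ _ _) => apply: crec_lookup
  | |- crec (fun x => _ + _) => apply: crec_add
  | |- crec (fun x => _ - _) => apply: crec_sub
  | |- crec (fun x => _.-1) => apply: crec_predn
  | |- crec (fun x => pi1 _) => apply: crec_fst
  | |- crec (fun x => pi2 _) => apply: crec_snd
  | |- crec (fun x => _.+1) => apply: crec_S
  | |- crec (fun x => if _ then _ else _) => apply: crec_if
  | |- crec (fun x => nat_of_bool (~~ _)) => apply: crec_negb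
  | |- crec (fun x => nat_of_bool (_ && _)) => apply: crec_andb
  | |- crec (fun x => nat_of_bool (_ ==> _)) => apply: crec_implb
  | |- crec (fun x => nat_of_bool (_ <= _)) => apply: crec_leq
  | |- crec (fun x => nat_of_bool (@eq_op (Equality.clone nat _) _ _)) => apply: crec_eq
  | |- crec (fun x => nat_of_bool (@eq_op (Equality.clone bool _) _ _)) => apply: crec_eqb
  | |- crec (fun x => nat_of_bool (@eq_op _ _ _)) => first [apply: crec_eq | apply: crec_eqb]
  | |- crec (fun x => nat_of_bool (all _ (iota 0 _))) => apply: crec_all
  | |- crec (fun x => nat_of_bool (has _ (iota 0 _))) => apply: crec_has
  | |- crec (fun x => nat_of_bool (odd _)) => apply: crec_odd
  | |- crec (fun x => half _) => apply: crec_half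
  | |- crec (fun x => 2 ^ _) => apply: crec_exp2
  | |- crec (fun x => _) => exact: crec_const
  end.
Ltac crec_auto := repeat (cbv beta; crec_step).

(** * Lists of numbers *)

(** With 0 for the empty list and n+1 for the list whose head and tail are unpaired from n, every
    number codes exactly one list. *)
Definition enc (s : seq nat) : nat := foldr consc 0 s.

Fixpoint dec_fuel k l : seq nat :=
  if k is k'.+1 then
    if l is l'.+1 then pi1 l' :: dec_fuel k' (pi2 l') else [::]
  else [::].
Definition dec l := dec_fuel l l.

Lemma leq_pi2 n : pi2 n <= n.
Proof. by rewrite -{2}(npairK n) leq_npair2. Qed.
Lemma leq_pi1 n : pi1 n <= n.
Proof. by rewrite -{2}(npairK n) leq_npair1. Qed.

Lemma decK : cancel dec enc.
Proof.
move=> l; rewrite /dec; move: {2 3}l (leqnn l) => k.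
elim: k l => [[]|k IH []] // l lt_lk /=.
by rewrite IH ?conscK //; apply: leq_trans (leq_pi2 l) _.
Qed.

Lemma enc_inj : injective enc.
Proof.
by elim=> [|a s IH] [|b t] //=; rewrite /consc => /succn_inj/npair_inj[-> /IH->]. Qed.

Lemma encK : cancel enc dec.
Proof. by move=> s; apply: enc_inj; rewrite decK. Qed.

Lemma dec_cons a l : dec (consc a l) = a :: dec l.
Proof. by apply: enc_inj; rewrite decK /= decK. Qed.

(** This inequality makes the recursive choice of Henkin witnesses well founded. *)
Lemma ltn_enc a s : a \in s -> a < enc s.
Proof.
elim: s => //= b s IH; rewrite inE => /predU1P[->|/IH lt_as].
  by rewrite /consc ltnS leq_npair1.
by rewrite /consc ltnS; apply: leq_trans (leq_npair2 _ _); apply: ltnW.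
Qed.

Lemma crec_size_dec a : crec a -> crec (fun x => size (dec (a x))).
Proof.
move=> aP; apply: (crec_app2 (f := fun _ n => size (dec n)) _ aP aP).
apply: (rec2_course_of_values (G := fun _ n t =>
  if n == 0 then 0 else (lookup t n (pi2 n.-1)).+1)); first by crec_auto.
move=> _ [|n] //; rewrite (lookupE (fun n => size (dec n))); last exact: leq_pi2.
by rewrite -{1}conscK dec_cons.
Qed.

Lemma crec_cat_dec a b : crec a -> crec b ->
  crec (fun x => enc (dec (a x) ++ dec (b x))).
Proof.
move=> aP bP; apply: (crec_app2 (f := fun m n => enc (dec n ++ dec m)) _ bP aP).
apply: (rec2_course_of_values (G := fun m n t =>
  if n == 0 then m else consc (pi1 n.-1) (lookup t n (pi2 n.-1)))); first by crec_auto.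
move=> m [|n]; first by rewrite /= decK.
rewrite (lookupE (fun n => enc (dec n ++ dec m))); last exact: leq_pi2.
by rewrite -{1}conscK dec_cons.
Qed.

(** * Terms evaluated on reversed tuples *)

(* The operators act at the end of a tuple, so tuples are stored reversed, and
   the operators then act at the head of the list. *)
Definition adholds A k (R : ADrel A k) (s : seq A) : Prop :=
  exists2 t : k.-tuple A, R t & tval t = rev s.

Section ADRelations.
Variables (A : Type) (k : nat).
Implicit Types (R : ADrel A k) (s : seq A).

Lemma adholds_size R s : adholds R s -> size s = k.
Proof. by case=> t _ Et; rewrite -size_rev -Et size_tuple. Qed.

(** Reversal turns a right rotation into a left one. In arity at most 1 rotations are trivial, so
    the degenerate case obeys the same law. *)
Lemma adholds_p R s : adholds (ad_p R) (rot 1 s) <-> adholds R s.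
Proof.
case: (ltnP 1 k) => [|le_k1].
  rewrite /adholds rev_rot; case: k R => [|[|n]] R //= _.
  split=> [[t [u Ru ->] /rotr_inj]|[u Ru Eu]]; first by exists u.
  by exists [tuple of rotr 1 u]; [exists u | rewrite /= Eu].
have -> : ad_p R = R by case: k R le_k1 => [|[]].
have E : size s = k -> rot 1 s = s by move=> Es; apply: rot_oversize; rewrite Es.
by split=> [/[dup]/adholds_size|/[dup]/adholds_size]; rewrite ?size_rot => /E->.
Qed.

(** In arity at most 1 both sides fail because the lists are too long. *)
Lemma adholds_s R a b s : adholds (ad_s R) [:: a, b & s] <-> adholds R [:: b, a & s].
Proof.
case: (ltnP 1 k) => [|le_k1]; last first.
  by split=> /adholds_size Es; exfalso; move: Es le_k1 => /= <-.
case: k R => [|[|n]] R // _.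
have revE c d : rev [:: c, d & s] = rev s ++ [:: d; c].
  by rewrite !rev_cons -!cats1 -catA.
rewrite /adholds !revE /=.
split=> [[t [u Ru [w [c [d [Eu Et]]]]] Et']|[u Ru Eu]].
  exists u => //; move: Et'; rewrite Et Eu => E.
  have szE : size w = size (rev s) by move/(congr1 size): E; rewrite !size_cat /=; lia.
  have [-> E2] : w = rev s /\ [:: d; c] = [:: b; a].
    split; first by move/(congr1 (take (size w))): E; rewrite take_size_cat // szE take_size_cat.
    by move/(congr1 (drop (size w))): E; rewrite drop_size_cat // szE drop_size_cat.
  by case: E2 => -> ->.
have szt : size (rev s ++ [:: b; a]) == n.+2.
  by rewrite -(size_tuple u) Eu !size_cat.
exists (Tuple szt) => //; exists u => //.
by exists (rev s), a, b.
Qed.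

Lemma ad_s_small R : k <= 1 -> ad_s R = R.
Proof. by case: k R => [|[]]. Qed.

Lemma adholds_I R a s : 1 < k ->
  adholds (ad_I R) (a :: s) <-> adholds R [:: a, a & s].
Proof.
case: k R => [|[|n]] R // _; rewrite /adholds /= !rev_cons.
split=> [[t [u Ru [w [c [Eu Et]]]] Et']|[u Ru Eu]].
  move: Et'; rewrite Et cats1 => /rcons_inj[Ew Ec].
  by exists u => //; rewrite Eu Ew Ec -cat_rcons cats1.
have szt : size (rcons (rev s) a) == n.+1.
  by rewrite -eqSS -(size_tuple u) Eu !size_rcons.
exists (Tuple szt) => //; exists u => //.
by exists (rev s), a; rewrite Eu -cat_rcons !cats1.
Qed.

Lemma adholds_I_small R s : k <= 1 -> adholds (ad_I R) s <-> adholds R s.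
Proof. by case: k R => [|[]]. Qed.

Lemma adholds_ex R s : 0 < k -> adholds (ad_ex R) s <-> exists a, adholds R (a :: s).
Proof.
case: k R => [|n] R // _.
split=> [[t [u Ru [a Eu]] Et]|[a [u Ru Eu]]].
  by exists a, u => //; rewrite Eu rev_cons Et.
have szt : size (rev s) == n by rewrite -eqSS -(size_tuple u) Eu !size_rev.
by exists (Tuple szt) => //; exists u => //; exists a; rewrite Eu rev_cons.
Qed.

Lemma adholds_ex_small R s : k = 0 -> adholds (ad_ex R) s <-> adholds R s.
Proof. by case: k R. Qed.

(** A list of the wrong length lies in neither [R] nor its complement, hence the condition on the
    length. *)
Lemma adholds_neg R s : size s = k -> adholds (ad_neg R) s <-> ~ adholds R s.
Proof.
move=> Es; have szt : size (rev s) == k by rewrite size_rev Es.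
split=> [[t Rt Et] [u Ru Eu]|nR]; last by exists (Tuple szt) => // Rt; apply: nR; exists (Tuple szt).
by apply: Rt; rewrite (_ : t = u) //; apply: val_inj; rewrite /= Et.
Qed.

End ADRelations.

Lemma adholds_J A k l (R : ADrel A k) (Q : ADrel A l) s s' :
  size s = k -> size s' = l ->
  adholds (ad_J R Q) (s' ++ s) <-> adholds R s /\ adholds Q s'.
Proof.
move=> Es Es'; rewrite /adholds rev_cat.
split=> [[t [u [v [Ru Qv ->]]] /= E]|[[u Ru Eu] [v Qv Ev]]]; last first.
  by exists [tuple of u ++ v]; [exists u, v | rewrite /= Eu Ev].
have szE : size u = size (rev s) by rewrite size_tuple size_rev.
split; [exists u|exists v] => //.
  by move/(congr1 (take (size u))): E; rewrite take_size_cat // szE take_size_cat.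
by move/(congr1 (drop (size u))): E; rewrite drop_size_cat // szE drop_size_cat.
Qed.

Definition holds M T (s : seq (dom M)) : Prop := adholds (sem M T) s.

Section Holds.
Variable M : model.
Implicit Types (T U : term) (s : seq (dom M)).

Lemma holds_size T s : holds T s -> size s = ar T.
Proof. exact: adholds_size. Qed.

Lemma holds_p T s : holds (Tp T) (rot 1 s) <-> holds T s.
Proof. exact: adholds_p. Qed.

Lemma holds_s T a b s : holds (Ts T) [:: a, b & s] <-> holds T [:: b, a & s].
Proof. exact: adholds_s. Qed.

Lemma holds_s_small T s : ar T <= 1 -> holds (Ts T) s <-> holds T s.
Proof. by move=> leT; rewrite /holds /= ad_s_small. Qed.

Lemma holds_I T a s : 1 < ar T -> holds (TI T) (a :: s) <-> holds T [:: a, a & s].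
Proof. exact: adholds_I. Qed.

Lemma holds_I_small T s : ar T <= 1 -> holds (TI T) s <-> holds T s.
Proof. exact: adholds_I_small. Qed.

Lemma holds_ex T s : 0 < ar T -> holds (Tex T) s <-> exists a, holds T (a :: s).
Proof. exact: adholds_ex. Qed.

Lemma holds_ex_small T s : ar T = 0 -> holds (Tex T) s <-> holds T s.
Proof. exact: adholds_ex_small. Qed.

Lemma holds_neg T s : size s = ar T -> holds (Tneg T) s <-> ~ holds T s.
Proof. exact: adholds_neg. Qed.

Lemma holds_J T U s s' : size s = ar T -> size s' = ar U ->
  holds (TJ T U) (s' ++ s) <-> holds T s /\ holds U s'.
Proof. exact: adholds_J. Qed.

End Holds.

Arguments holds M T s : clear implicits.

Lemma satisfiableP T : satisfiable T <-> exists M s, holds M T s.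
Proof.
split=> [[M [t Tt]]|[M [s [t Tt _]]]]; last by exists M, t.
by exists M, (rev t), t; rewrite ?revK.
Qed.

(** * Existential closure *)

Definition ex_closure T := iter (ar T) Tex T.

Lemma ar_iter_ex n T : ar (iter n Tex T) = ar T - n.
Proof. by elim: n => [|n IH] /=; rewrite ?subn0 // IH subnS. Qed.

Lemma holds_iter_ex M T n s : n <= ar T ->
  holds M (iter n Tex T) s <-> exists2 s', size s' = n & holds M T (s' ++ s).
Proof.
elim: n s => [|n IH] s le_n /=.
  by split=> [?|[s' /size0nil->]] //; exists [::].
have arE : 0 < ar (iter n Tex T) by rewrite ar_iter_ex subn_gt0.
split=> [/(holds_ex _ arE)[a /(IH _ (ltnW le_n))[s' Es' Ts]]|[s']].
  by exists (rcons s' a); rewrite ?size_rcons ?Es' // cat_rcons.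
case/lastP: s' => // s' a; rewrite size_rcons cat_rcons => -[Es'] Ts.
by apply/(holds_ex _ arE); exists a; apply/(IH _ (ltnW le_n)); exists s'.
Qed.

Lemma holds_ex_closure M T : holds M (ex_closure T) [::] <-> exists s, holds M T s.
Proof.
rewrite holds_iter_ex //; split=> [[s _]|[s Ts]]; first by rewrite cats0; exists s.
by exists s; rewrite ?cats0 // (holds_size Ts).
Qed.

(** * Codes of terms *)

(** Arities are shifted by one here: the tests [2 < f p] and [1 < f p] stand for arity at least 2
    under [TI] and at least 1 under [Tex], and the predecessor in the case of [TJ] removes the
    second shift. *)
Definition code_ar_step (t p : nat) (f : nat -> nat) : nat :=
  if t == 0 then (pi1 p).+1
  else if t == 3 then f p - (2 < f p)
  else if t == 5 then
    if (0 < f (pi1 p)) && (0 < f (pi2 p)) then (f (pi1 p) + f (pi2 p)).-1 else 0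
  else if t == 6 then f p - (1 < f p)
  else if t <= 4 then f p else 0.

Fixpoint code_ar_fuel k n : nat :=
  if k is k'.+1 then code_ar_step (pi1 n) (pi2 n) (code_ar_fuel k') else 0.

(* [(ar T).+1] on the code of [T], and [0] on the numbers that code no term. *)
Definition code_ar n := code_ar_fuel n.+1 n.

(** Tag 0 makes no recursive call. This matters, since 0 = [npair 0 0] is its own second component;
    under a positive tag, [p] is smaller than the code. *)
Lemma code_ar_step_ext t p f g :
  (0 < t -> forall m, m <= p -> f m = g m) -> code_ar_step t p f = code_ar_step t p g.
Proof.
rewrite /code_ar_step; case: t => // t /(_ isT) fg /=.
by rewrite !fg ?leq_pi1 ?leq_pi2.
Qed.

Lemma ltn_pi2 n : 0 < pi1 n -> pi2 n < n.
Proof. by move=> gt0; rewrite -{2}(npairK n) ltn_npair2. Qed.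

Lemma code_ar_fuelE k n : n < k -> code_ar_fuel k n = code_ar n.
Proof.
suff H k1 k2 : n < k1 -> n < k2 -> code_ar_fuel k1 n = code_ar_fuel k2 n by move=> lt_nk; apply: H.
elim: k1 k2 n => // k1 IH [|k2] n //= lt1 lt2; apply: code_ar_step_ext => gt0 m le_m.
have lt_m : m < n by apply: leq_ltn_trans le_m (ltn_pi2 gt0).
by apply: IH; apply: leq_trans lt_m _.
Qed.

Lemma code_arE n : code_ar n = code_ar_step (pi1 n) (pi2 n) code_ar.
Proof.
rewrite {1}/code_ar /=; apply: code_ar_step_ext => gt0 m le_m; apply: code_ar_fuelE.
exact: leq_ltn_trans le_m (ltn_pi2 gt0).
Qed.

Lemma code_ar_code T : code_ar (code T) = (ar T).+1.
Proof.
elim: T => [k i|T IH|T IH|T IH|T IH|T IHT U IHU|T IH]; rewrite code_arE /= pi1P pi2P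
  /code_ar_step /= ?pi1P ?pi2P ?IH ?IHT ?IHU //=.
- by rewrite /arI; case: (ar T) => [|[|n]].
- by rewrite addnS.
- by case: (ar T).
Qed.

Lemma code_arP n : 0 < code_ar n -> exists T, code T = n.
Proof.
elim/ltn_ind: n => n; rewrite code_arE -{1 4}(npairK n).
have : 0 < pi1 n -> pi2 n < npair (pi1 n) (pi2 n) by rewrite npairK; apply: ltn_pi2.
move: (pi1 n) (pi2 n) => t p ltp IH; rewrite /code_ar_step.
case: t ltp IH => [_ _ _|t /(_ isT) ltp IH].
  by exists (Rel (pi1 p) (pi2 p)); rewrite /= npairK.
have IHp m : m <= p -> 0 < code_ar m -> exists T, code T = m.
  by move=> le_mp; apply: IH; apply: leq_ltn_trans ltp.
have pE : 0 < code_ar p -> exists T, code T = p by apply: IHp.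
clear IH ltp; case: t => [|[|[|[|[|[|t]]]]]] //=.
- by case/pE=> T <-; exists (Tp T).
- by case/pE=> T <-; exists (Ts T).
- by move=> gt0; case: pE => [|T <-]; [apply: leq_trans gt0 (leq_subr _ _)|exists (TI T)].
- by case/pE=> T <-; exists (Tneg T).
- case: ifP => // /andP[gt1 gt2] _.
  case: (IHp _ (leq_pi1 p) gt1) (IHp _ (leq_pi2 p) gt2) => T ET [U EU].
  by exists (TJ T U); rewrite /= ET EU npairK.
- by move=> gt0; case: pE => [|T <-]; [apply: leq_trans gt0 (leq_subr _ _)|exists (Tex T)].
Qed.

Lemma code_arS n k : code_ar n = k.+1 -> exists2 T, code T = n & ar T = k.
Proof.
move=> En; have [T ET] : exists T, code T = n by apply: code_arP; rewrite En.
by exists T => //; move: En; rewrite -ET code_ar_code => -[].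
Qed.

Lemma crec_code_ar a : crec a -> crec (fun x => code_ar (a x)).
Proof.
move=> aP; apply: (crec_app2 (f := fun _ n => code_ar n) _ aP aP).
apply: (rec2_course_of_values (G := fun _ n t =>
  code_ar_step (pi1 n) (pi2 n) (lookup t n))).
  by rewrite /code_ar_step; crec_auto.
move=> _ n; rewrite code_arE; apply: code_ar_step_ext => gt0 m le_m.
by rewrite (lookupE code_ar) //; apply: leq_ltn_trans le_m (ltn_pi2 gt0).
Qed.

(** * Hintikka assignments *)

(* [V u l] is the truth value of the term coded by [u] on the list coded by [l].
   The number [npair u l] serves as the Henkin witness of the quantifier of
   [Tex U] on [l], where [u] codes [U]. The guard [g] restricts the conditions
   to a part of the assignment. *)
Definition local_conditions (g V : nat -> nat -> bool) (u w l m a : nat) : bool :=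
  let s := size (dec l) in
  let al := consc a l in
  let agree u' l' l'' := g u' l' && g u l'' ==> (V u' l' == V u l'') in
  (* [code_ar] is the arity plus one, so [s.+2] demands a term of arity s+1, the length of [al]; the
     other list is its rotation, with [a] at the end. *)
  [&& (code_ar u == s.+2) ==> agree (npair 1 u) (enc (dec l ++ dec (consc a 0))) al,
      (code_ar u == 1) && (l == 0) ==> agree (npair 1 u) 0 0,
      (code_ar u == s.+3) ==> agree (npair 2 u) (consc a (consc m l)) (consc m al),
      (code_ar u == s.+1) && (code_ar u <= 2) ==> agree (npair 2 u) l l,
      (code_ar u == s.+3) ==> agree (npair 3 u) al (consc a al),
      (code_ar u == s.+1) && (code_ar u <= 2) ==> agree (npair 3 u) l l,
      (code_ar u == s.+1) ==> g (npair 4 u) l && g u l ==> (V (npair 4 u) l == ~~ V u l),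
      (code_ar u == s.+1) && (code_ar w == (size (dec m)).+1) ==>
        [&& g (npair 5 (npair u w)) (enc (dec m ++ dec l)), g u l & g w m] ==>
        (V (npair 5 (npair u w)) (enc (dec m ++ dec l)) == V u l && V w m),
      (code_ar u == s.+2) ==> g (npair 6 u) l && g u al ==> (V u al ==> V (npair 6 u) l),
      (code_ar u == s.+2) ==>
        g (npair 6 u) l && g u (consc (npair u l) l) ==>
        (V (npair 6 u) l ==> V u (consc (npair u l) l)) &
      (code_ar u == 1) && (l == 0) ==> agree (npair 6 u) 0 0].

Definition below n (u l : nat) := (u < n) && (l < n).

Definition conditions_below (n : nat) (V : nat -> nat -> bool) : bool :=
  all (fun u => all (fun w => all (fun l => all (fun m => all (fun a =>
    local_conditions (below n) V u w l m a)
    (iota 0 n)) (iota 0 n)) (iota 0 n)) (iota 0 n)) (iota 0 n).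

Lemma conditions_belowP n V :
  reflect (forall u w l m a, u < n -> w < n -> l < n -> m < n -> a < n ->
    local_conditions (below n) V u w l m a) (conditions_below n V).
Proof.
have iotaE i : (i \in iota 0 n) = (i < n) by rewrite mem_iota.
apply: (iffP allP) => [H u w l m a ltu ltw ltl ltm lta|H u].
  have inI i : i < n -> i \in iota 0 n by rewrite iotaE.
  have /allP/(_ w (inI _ ltw))/allP/(_ l (inI _ ltl)) := H u (inI _ ltu).
  by move/allP/(_ m (inI _ ltm))/allP/(_ a (inI _ lta)).
rewrite iotaE => ltu; apply/allP=> w; rewrite iotaE => ltw; apply/allP=> l.
rewrite iotaE => ltl; apply/allP=> m; rewrite iotaE => ltm; apply/allP=> a.
by rewrite iotaE => lta; apply: H.
Qed.

Lemma local_conditions_ext (g V V' : nat -> nat -> bool) u w l m a :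
  (forall u l, g u l -> V u l = V' u l) ->
  local_conditions g V u w l m a = local_conditions g V' u w l m a.
Proof.
move=> E; rewrite /local_conditions.
have E2 u1 l1 u2 l2 (F : bool -> bool -> bool) :
    (g u1 l1 && g u2 l2 ==> F (V u1 l1) (V u2 l2)) =
    (g u1 l1 && g u2 l2 ==> F (V' u1 l1) (V' u2 l2)).
  by case: (boolP (_ && _)) => //= /andP[/E-> /E->].
have E3 u1 l1 u2 l2 u3 l3 (F : bool -> bool -> bool -> bool) :
    ([&& g u1 l1, g u2 l2 & g u3 l3] ==> F (V u1 l1) (V u2 l2) (V u3 l3)) =
    ([&& g u1 l1, g u2 l2 & g u3 l3] ==> F (V' u1 l1) (V' u2 l2) (V' u3 l3)).
  by case: (boolP [&& _, _ & _]) => //= /and3P[/E-> /E-> /E->].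
congr [&& _ ==> _, _ ==> _, _ ==> _, _ ==> _, _ ==> _, _ ==> _, _ ==> _, _ ==> _,
  _ ==> _, _ ==> _ & _ ==> _].
all: try exact: (E2 _ _ _ _ (fun a b => a == b)).
- exact: (E2 _ _ _ _ (fun a b => a == ~~ b)).
- exact: (E3 _ _ _ _ _ _ (fun a b c => a == b && c)).
- exact: (E2 _ _ _ _ (fun a b => b ==> a)).
- exact: (E2 _ _ _ _ (fun a b => a ==> b)).
Qed.

Lemma conditions_below_ext n V V' :
  (forall u l, u < n -> l < n -> V u l = V' u l) ->
  conditions_below n V = conditions_below n V'.
Proof.
move=> E; do 5 (apply: eq_all => ?); apply: local_conditions_ext => u l /andP[].
exact: E.
Qed.

(** A condition mentions only the finitely many numbers in [L], and below one more than their sum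
    all its guards hold. *)
Lemma local_conditionsT V : (forall n, conditions_below n V) ->
  forall u w l m a, local_conditions (fun _ _ => true) V u w l m a.
Proof.
move=> VP u w l m a.
set L := [:: w; m; a; u; l; npair 1 u; enc (dec l ++ dec (consc a 0)); consc a l; 0;
  npair 2 u; consc a (consc m l); consc m (consc a l); npair 3 u;
  consc a (consc a l); npair 4 u; npair 5 (npair u w); enc (dec m ++ dec l);
  npair 6 u; consc (npair u l) l].
have ltL x : x \in L -> x < (sumn L).+1.
  elim: L => //= y L IH; rewrite inE => /predU1P[->|/IH]; lia.
have /conditions_belowP/(_ u w l m a) := VP (sumn L).+1.
rewrite !(ltL _ _) ?inE ?eqxx ?orbT // => /(_ isT isT isT isT isT).
move: ltL; move: (sumn L).+1 => n ltL.
by rewrite /local_conditions /below !(ltL _ _) ?inE ?eqxx ?orbT.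
Qed.

(** * Finite assignments as binary numbers *)

Definition bit (b i : nat) : bool := odd (iter i half b).

Lemma bits_exist (V : nat -> bool) N :
  exists2 b, b < 2 ^ N & forall i, i < N -> bit b i = V i.
Proof.
elim: N V => [|N IH] V; first by exists 0.
have [b ltb bV] := IH (fun i => V i.+1).
exists (V 0 + b.*2); first by rewrite expnS; case: (V 0); lia.
case=> [_|i lti]; first by rewrite /bit /= oddD odd_double addbF oddb.
by rewrite /bit iterSr half_bit_double; apply: bV.
Qed.

Lemma crec_bit a b : crec a -> crec b -> crec (fun x => bit (a x) (b x)).
Proof.
move=> aP bP; apply: crec_odd; apply: (crec_iter (g := fun _ => half)) => //.
exact: crec_half crec_pi2.
Qed.

Ltac crec_conditions := repeat (cbv beta; first
  [ lazymatch goal with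
    | |- crec (fun x => nat_of_bool (bit _ _)) => apply: crec_bit
    | |- crec (fun x => code_ar _) => apply: crec_code_ar
    | |- crec (fun x => size (dec _)) => apply: crec_size_dec
    | |- crec (fun x => enc (dec _ ++ dec _)) => apply: crec_cat_dec
    end
  | crec_step ]).

Definition bit_assignment b u l := bit b (npair u l).

Lemma crec_conditions_below a b : crec a -> crec b ->
  crec (fun x => conditions_below (a x) (bit_assignment (b x))).
Proof.
move=> aP bP.
apply: (crec_app2 (f := fun n b => nat_of_bool (conditions_below n (bit_assignment b))) _ aP bP).
apply: rec2_crec; rewrite /conditions_below /local_conditions /below /bit_assignment.
by crec_conditions.
Qed.

(** A form of weak Koenig's lemma: a prefix that extends, for every [n], to a solution of the
    conditions up to [n] is prolonged bit by bit. *)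
Lemma compactness (P : nat -> (nat -> bool) -> Prop) (bound : nat -> nat) :
  (forall n V V', (forall i, i < bound n -> V i = V' i) -> P n V -> P n V') ->
  (forall n, exists V, forall m, m <= n -> P m V) ->
  exists V, forall n, P n V.
Proof.
move=> Pext Pfin.
pose ext p n := exists2 V : nat -> bool,
  (forall i, i < size p -> V i = nth false p i) & forall m, m <= n -> P m V.
have ext_rcons p : (forall n, ext p n) -> exists b, forall n, ext (rcons p b) n.
  move=> pP; apply: NNPP => nP.
  have nE b : exists n, ~ ext (rcons p b) n.
    by apply: not_all_ex_not => bP; apply: nP; exists b.
  have [[n1 nP1] [n2 nP2]] := (nE true, nE false).
  (* If the two prolongations failed at [n1] and [n2], a solution up to the maximum would pick one
     of the bits and refute that failure. *)
  have [V Vp VP] := pP (maxn n1 n2).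
  have rP n : n <= maxn n1 n2 -> ext (rcons p (V (size p))) n.
    move=> le_n; exists V => [i|m le_mn]; last exact/VP/(leq_trans le_mn).
    rewrite size_rcons ltnS leq_eqVlt nth_rcons => /predU1P[->|lt_i].
      by rewrite ltnn eqxx.
    by rewrite lt_i Vp.
  case E: (V (size p)) rP => rP.
    by apply: nP1; apply: rP; apply: leq_maxl.
  by apply: nP2; apply: rP; apply: leq_maxr.
have next p : {b | (forall n, ext p n) -> forall n, ext (rcons p b) n}.
  apply: constructive_indefinite_description.
  case: (classic (forall n, ext p n)) => [/ext_rcons[b bP]|nP]; first by exists b.
  (* A default for prefixes without extensions, which the construction never reaches. *)
  by exists true => /nP.
pose prefix n := iter n (fun p => rcons p (sval (next p))) [::].
have szp n : size (prefix n) = n by elim: n => //= n; rewrite size_rcons => ->.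
have extp n : forall k, ext (prefix n) k.
  elim: n => [k|n IH] /=; last exact: svalP (next _) IH.
  by have [V VP] := Pfin k; exists V.
pose V i := nth false (prefix i.+1) i.
have VE i n : i < n -> nth false (prefix n) i = V i.
  elim: n => // n IH; rewrite ltnS leq_eqVlt => /predU1P[->//|lt_in] /=.
  by rewrite nth_rcons szp lt_in IH.
(* The prefix of length [bound n] extends to a solution of [P n], and [P n] reads no further
   bits. *)
exists V => n; have [V' V'p V'P] := extp (bound n) n.
apply: Pext (V'P n (leqnn n)) => i lti.
by rewrite V'p ?szp // VE.
Qed.

Definition Pbool (P : Prop) : bool := excluded_middle_informative P.

Lemma PboolP (P : Prop) : reflect P (Pbool P).
Proof. by rewrite /Pbool; case: excluded_middle_informative => ?; constructor. Qed.

(** * From a model to a Hintikka assignment *)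

Section Soundness.
Variable M : model.

(** The value of [h] at [npair (code U) l] depends on [h] only at the entries of [l], which are
    smaller numbers. So [h] is built by course-of-values recursion, with [epsilon] choosing a
    witness if there is one. *)
Lemma henkin_witnesses : exists h : nat -> dom M, forall U l,
  (exists a, holds M U (a :: map h (dec l))) ->
  holds M U (h (npair (code U) l) :: map h (dec l)).
Proof.
have [d] := dom_nonempty M.
pose step n (f : nat -> dom M) := epsilon (inhabits d) (fun a =>
  exists2 U, code U = pi1 n & holds M U (a :: map f (dec (pi2 n)))).
pose prefix := fix prefix n :=
  if n is n'.+1 then rcons (prefix n') (step n' (nth d (prefix n'))) else [::].
pose h n := step n (nth d (prefix n)).
have szp n : size (prefix n) = n by elim: n => //= n; rewrite size_rcons => ->.
have hE i n : i < n -> nth d (prefix n) i = h i.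
  elim: n => // n IH; rewrite ltnS leq_eqVlt /= nth_rcons szp => /predU1P[->|lt_in].
    by rewrite ltnn eqxx.
  by rewrite lt_in IH.
exists h => U l [a Ua].
have mapE : map (nth d (prefix (npair (code U) l))) (dec l) = map h (dec l).
  apply/eq_in_map => i /ltn_enc; rewrite decK => lt_il; apply: hE.
  exact: leq_trans lt_il (leq_npair2 _ _).
rewrite {1}/h /step pi1P pi2P mapE.
set Q := fun a => _.
have : Q (epsilon (inhabits d) Q) by apply: epsilon_spec; exists a, U.
by case=> U' /code_inj->.
Qed.

(** Reading numbers as elements through [h] turns each condition into the truth clause of an
    operator; the choice of [h] yields the witness condition for [Tex]. *)
Lemma model_conditions (h : nat -> dom M) :
  (forall U l, (exists a, holds M U (a :: map h (dec l))) ->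
    holds M U (h (npair (code U) l) :: map h (dec l))) ->
  let V u l := Pbool (exists2 U, code U = u & holds M U (map h (dec l))) in
  forall g u w l m a, local_conditions g V u w l m a.
Proof.
move=> hP V g u w l m a.
have VE U k : V (code U) k = Pbool (holds M U (map h (dec k))).
  apply/PboolP/PboolP => [[U' /code_inj->]|]; last by exists U.
  by [].
have eqV (P Q : Prop) (b : bool) : (P <-> Q) -> b ==> (Pbool P == Pbool Q).
  by move=> PQ; apply/implyP=> _; apply/eqP; apply/PboolP/PboolP => /PQ.
rewrite /local_conditions; repeat (apply/andP; split); apply/implyP.
- move=> /eqP/code_arS[U <- arU]; rewrite (VE (Tp U)) !VE encK !dec_cons map_cat /=.
  apply: eqV; rewrite -(holds_p U (h a :: _)) rot1_cons -cats1.
  by [].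
- case/andP=> /eqP/code_arS[U <- arU] _; rewrite (VE (Tp U)) !VE.
  by apply: eqV; rewrite -(holds_p U [::]).
- move=> /eqP/code_arS[U <- arU]; rewrite (VE (Ts U)) !VE !dec_cons.
  by apply: eqV; apply: holds_s.
- case/andP=> /eqP Ea; rewrite Ea; move/code_arS: Ea => [U <- arU] leU.
  by rewrite (VE (Ts U)) !VE; apply: eqV; apply: holds_s_small; rewrite arU.
- move=> /eqP/code_arS[U <- arU]; rewrite (VE (TI U)) !VE !dec_cons.
  by apply: eqV; apply: holds_I; rewrite arU.
- case/andP=> /eqP Ea; rewrite Ea; move/code_arS: Ea => [U <- arU] leU.
  by rewrite (VE (TI U)) !VE; apply: eqV; apply: holds_I_small; rewrite arU.
- move=> /eqP/code_arS[U <- arU]; rewrite (VE (Tneg U)) !VE.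
  apply/implyP=> _; have := @holds_neg M U (map h (dec l)); rewrite size_map arU => /(_ erefl) E.
  by apply/eqP; apply/PboolP/idP => [/E nU|/PboolP nU]; [apply/PboolP|apply/E].
- case/andP=> /eqP/code_arS[U <- arU] /eqP/code_arS[W <- arW].
  rewrite (VE (TJ U W)) !VE encK map_cat; apply/implyP=> _.
  have [] := @holds_J M U W (map h (dec l)) (map h (dec m)); rewrite ?size_map ?arU //.
  move=> J1 J2; apply/eqP; apply/PboolP/andP => [/J1[U1 W1]|[/PboolP U1 /PboolP W1]].
    by split; apply/PboolP.
  exact: J2.
- move=> /eqP/code_arS[U <- arU]; rewrite (VE (Tex U)) !VE dec_cons.
  have exU := @holds_ex M U (map h (dec l)); rewrite arU in exU.
  apply/implyP=> _; apply/implyP=> /PboolP Ua; apply/PboolP/exU => //.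
  by exists (h a).
- move=> /eqP/code_arS[U <- arU]; rewrite (VE (Tex U)) !VE dec_cons.
  have exU := @holds_ex M U (map h (dec l)); rewrite arU in exU.
  by apply/implyP=> _; apply/implyP=> /PboolP/exU UE; apply/PboolP/hP/UE.
- case/andP=> /eqP/code_arS[U <- arU] _; rewrite (VE (Tex U)) !VE.
  by apply: eqV; apply: holds_ex_small.
Qed.

End Soundness.

(** * From a Hintikka assignment to a model *)

Section Completeness.
Variable V : nat -> nat -> bool.
Hypothesis VP : forall u w l m a, local_conditions (fun _ _ => true) V u w l m a.

Definition assignment_model : model :=
  @Model nat (inhabits 0) (fun k i t => V (code (Rel k i)) (enc (rev t))).

(** The truth lemma. Every list over the domain has a code, so the conditions cover all tuples, and
    in the case of [Tex] the number [npair (code T) (enc s)] is itself an element. *)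
Lemma assignment_modelP T s :
  size s = ar T -> holds assignment_model T s <-> V (code T) (enc s).
Proof.
have arE W r n : size r + n = ar W -> (code_ar (code W) == (size r + n).+1).
  by rewrite code_ar_code => ->.
elim: T s => [k i|T IH|T IH|T IH|T IH|T IHT U IHU|T IH] s /= Es.
- split=> [[t Vt Et]|Vs].
    by rewrite -(revK s) -Et.
  have szs : size (rev s) == k by rewrite size_rev Es.
  by exists (Tuple szs); rewrite //= revK.
- case/lastP: s Es => [|r a] Es.
    (* The second 0 is the code of the empty list; the other zeros are arbitrary fillers. *)
    have := VP (code T) 0 0 0 0; rewrite /local_conditions code_ar_code -Es.
    case/and3P=> _ /eqP-> _; apply: iff_trans _ (IH [::] Es).
    exact: (holds_p (M := assignment_model) T [::]).
  have := VP (code T) 0 (enc r) 0 a; rewrite /local_conditions code_ar_code encK -Es size_rcons.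
  rewrite eqxx dec_cons cats1 => /andP[/eqP-> _].
  rewrite -[consc _ _]/(enc (a :: r)) -IH; last by rewrite -Es size_rcons.
  by rewrite -rot1_cons; exact: (holds_p (M := assignment_model) T (a :: r)).
- case: s Es => [|a [|b r]] Es.
  + have := VP (code T) 0 (enc [::]) 0 0; rewrite /local_conditions code_ar_code encK -Es.
    case/and5P=> _ _ _ /eqP-> _; rewrite -IH //; apply: holds_s_small.
    by rewrite -Es.
  + have := VP (code T) 0 (enc [:: a]) 0 0; rewrite /local_conditions code_ar_code encK -Es.
    case/and5P=> _ _ _ /eqP-> _; rewrite -IH //; apply: holds_s_small.
    by rewrite -Es.
  have := VP (code T) 0 (enc r) b a; rewrite /local_conditions code_ar_code encK -Es eqxx.
  case/and3P=> _ _ /andP[/eqP-> _]; rewrite -[consc b _]/(enc [:: b, a & r]) -IH //.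
  exact: (holds_s (M := assignment_model) T).
- have [gt1|le1] := ltnP 1 (ar T); last first.
    have arTE : size s = ar T by rewrite Es; case: (ar T) le1 => [|[]].
    have := VP (code T) 0 (enc s) 0 0; rewrite /local_conditions code_ar_code encK -arTE.
    rewrite eqxx ltnS arTE le1.
    case/and5P=> _ _ _ _ /and3P[_ /eqP-> _]; rewrite -IH //; exact: holds_I_small.
  have {}Es : (size s).+1 = ar T by rewrite Es; case: (ar T) gt1 => [|[]].
  case: s Es => [|a r] Es; first by rewrite -Es in gt1.
  have := VP (code T) 0 (enc r) 0 a; rewrite /local_conditions code_ar_code encK -Es eqxx.
  case/and5P=> _ _ _ _ /andP[/eqP-> _].
  rewrite -[consc _ _]/(enc [:: a, a & r]) -IH //.
  exact: holds_I.
- have := VP (code T) 0 (enc s) 0 0; rewrite /local_conditions code_ar_code encK -Es eqxx.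
  case/and5P=> _ _ _ _ /and3P[_ _ /andP[/eqP-> _]].
  apply: iff_trans (holds_neg (M := assignment_model) Es) _; rewrite IH //.
  by split=> /negP.
- set r := drop (ar U) s; set r' := take (ar U) s.
  have Er : size r = ar T by rewrite size_drop Es addnK.
  have Er' : size r' = ar U by rewrite size_takel // Es leq_addl.
  have := VP (code T) (code U) (enc r) (enc r') 0; rewrite /local_conditions !code_ar_code !encK.
  rewrite Er Er' !eqxx cat_take_drop => /and5P[_ _ _ _ /and5P[_ _ _ /eqP-> _]].
  rewrite -{1}(cat_take_drop (ar U) s).
  apply: iff_trans (holds_J (M := assignment_model) Er Er') _; rewrite IHT // IHU //.
  by split=> /andP.
- case EaT: (ar T) Es => [|n] /= Es.
    have -> : s = [::] by case: s Es.
    have := VP (code T) 0 0 0 0; rewrite /local_conditions code_ar_code EaT.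
    case/and5P=> _ _ _ _ /and5P[_ _ _ _ /and3P[_ _ /eqP->]].
    by apply: iff_trans _ (IH [::] _) => //; apply: holds_ex_small.
  have := VP (code T) 0 (enc s) 0; rewrite /local_conditions code_ar_code EaT encK Es eqxx => VC.
  have exT := holds_ex (M := assignment_model) (T := T) s; rewrite EaT in exT.
  apply: iff_trans (exT isT) _; split=> [[a]|Vs].
    rewrite IH /= ?Es // => Va.
    by have /and5P[_ _ _ _ /and5P[_ _ _ _ /andP[/implyP H _]]] := VC a; apply: (implyP (implyP (H isT) isT)).
  exists (npair (code T) (enc s)); rewrite IH /= ?Es //.
  by have /and5P[_ _ _ _ /and5P[_ _ _ _ /and3P[_ /implyP H _]]] := VC 0; apply: (implyP (implyP (H isT) isT)).
Qed.

End Completeness.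

(** * The satisfiability problem is co-recursively enumerable *)

Definition ex_closure_code x := iter (code_ar x).-1 (npair 6) x.

Lemma ex_closure_codeE T : ex_closure_code (code T) = code (ex_closure T).
Proof. by rewrite /ex_closure_code code_ar_code /ex_closure /=; elim: (ar T) => //= n ->. Qed.

(** The truth of the closure is demanded only once its code is below [n]; thus only values below [n]
    are read, as compactness requires. *)
Definition consistent_at (x n : nat) (V : nat -> nat -> bool) : bool :=
  conditions_below n V && ((ex_closure_code x < n) ==> V (ex_closure_code x) 0).

(** A single [b] serves all [m] up to [n], which is the finite hypothesis of compactness. For [u]
    and [l] below [n] the index [npair u l] is below [npair n n], so that many bits suffice. *)
Definition consistent_upto (x n : nat) : bool :=
  (0 < code_ar x) &&
  has (fun b => all (fun m => consistent_at x m (bit_assignment b)) (iota 0 n.+1))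
      (iota 0 (2 ^ npair n n)).

Lemma recursive_consistent_upto : recursive_rel consistent_upto.
Proof.
suff cP : crec (fun p => consistent_upto (pi1 p) (pi2 p)).
  apply: total_recursive_ext (rec2_crec (f := fun x n => consistent_upto x n) cP).
  by move=> v; rewrite !(tnth_nth 0).
have closureP a : crec a -> crec (fun x => ex_closure_code (a x)).
  move=> aP; apply: (crec_iter (g := fun _ => npair 6)) => //.
    by apply: crec_predn; apply: crec_code_ar.
  exact: crec_npair (crec_const 6) crec_pi2.
rewrite /consistent_upto /consistent_at /bit_assignment.
repeat (cbv beta; first
  [ lazymatch goal with
    | |- crec (fun x => nat_of_bool (conditions_below _ _)) => apply: crec_conditions_below
    | |- crec (fun x => ex_closure_code _) => apply: closureP
    end
  | progress crec_conditions]).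
Qed.

Lemma sat_problemP x : sat_problem x <-> forall n, consistent_upto x n.
Proof.
split=> [[T <- /satisfiableP[M /holds_ex_closure Tsat]] n|xP].
  have [h /model_conditions] := henkin_witnesses M.
  set V := fun u l => _; move=> VP.
  have VT : V (code (ex_closure T)) 0 by apply/PboolP; exists (ex_closure T).
  rewrite /consistent_upto code_ar_code; apply/andP; split=> //.
  have [b ltb bV] := bits_exist (fun i => V (pi1 i) (pi2 i)) (npair n n).
  have VE m u l : m <= n -> u < m -> l < m -> V u l = bit_assignment b u l.
    move=> le_mn ltu ltl; rewrite /bit_assignment bV ?pi1P ?pi2P //.
    by apply: npair_ltn; apply: leq_trans le_mn.
  apply/hasP; exists b; first by rewrite mem_iota.
  apply/allP=> m; rewrite mem_iota ltnS /= => le_mn; apply/andP; split.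
    rewrite -(conditions_below_ext (fun u l => VE m u l le_mn)).
    by apply/conditions_belowP=> *; apply: VP.
  rewrite ex_closure_codeE; apply/implyP=> lt_m; rewrite -(VE m) //.
  exact: leq_ltn_trans lt_m.
have [T ET] : exists T, code T = x by apply: code_arP; case/andP: (xP 0).
exists T => //; apply/satisfiableP; subst x.
pose P n (W : nat -> bool) := consistent_at (code T) n (fun u l => W (npair u l)).
have [W WP] : exists W, forall n, P n W.
  apply: (compactness (bound := fun n => npair n n)) => [n W W' WW'|n].
    have E u l : u < n -> l < n -> W (npair u l) = W' (npair u l).
      by move=> ltu ltl; apply/WW'/npair_ltn.
    case/andP=> W1 W2; apply/andP; split; first by rewrite -(conditions_below_ext E).
    by apply/implyP=> lt_n; rewrite -E ?(implyP W2) //; apply: leq_ltn_trans lt_n.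
  case/andP: (xP n) => _ /hasP[b _ /allP bP]; exists (bit b) => m le_mn.
  by apply: bP; rewrite mem_iota ltnS.
set V := fun u l => W (npair u l).
have VP : forall n, conditions_below n V by move=> n; case/andP: (WP n).
have VT : V (code (ex_closure T)) 0.
  (* This is the first bound at which the truth of the closure is demanded. *)
  by case/andP: (WP (code (ex_closure T)).+1) => _; rewrite ex_closure_codeE leqnn.
exists (assignment_model V); apply/holds_ex_closure.
by apply/(assignment_modelP (local_conditionsT VP)); rewrite ?ar_iter_ex ?subnn.
Qed.

Lemma sat_problem_Pi01 : Pi01 sat_problem.
Proof.
exists consistent_upto; first exact: recursive_consistent_upto.
exact: sat_problemP.
Qed.

(** * Horn clauses as terms *)

Lemma ar_iter (F : term -> term) m T :
  (forall U, ar (F U) = ar U) -> ar (iter m F T) = ar T.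
Proof. by move=> FE; elim: m => //= m <-. Qed.

(* From a term for [T(x_1, ..., x_(n+1))], the term for [T(s, s_j)]. Applying
   [Tp] after [Ts] rotates all the entries but the last. *)
Definition diag n j T :=
  iter (n - j) Tp (TI (iter j (fun U => Tp (Ts U)) T)).

Lemma ar_diag n j T : ar T = n.+1 -> 0 < n -> ar (diag n j T) = n.
Proof.
move=> arT; rewrite /diag ar_iter //= ar_iter // arT.
by case: n {arT}.
Qed.

Section HoldsClauses.
Variables (M : model) (d : dom M).
Implicit Types (T U : term) (s : seq (dom M)).

Lemma holds_iter_p m T s :
  m <= size s -> holds M (iter m Tp T) (rot m s) <-> holds M T s.
Proof.
elim: m => [|m IH] le_m; first by rewrite rot0.
by rewrite rotS //=; apply: iff_trans (holds_p _ _) (IH (ltnW le_m)).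
Qed.

Lemma holds_ps T y s : 0 < size s ->
  holds M (Tp (Ts T)) (y :: rot 1 s) <-> holds M T (y :: s).
Proof.
case: s => // a s _; rewrite rot1_cons -rcons_cons -rot1_cons.
exact: iff_trans (holds_p _ _) (holds_s _ _ _ _).
Qed.

Lemma holds_iter_ps m T y s : 0 < size s -> m <= size s ->
  holds M (iter m (fun U => Tp (Ts U)) T) (y :: rot m s) <-> holds M T (y :: s).
Proof.
move=> gt0; elim: m => [|m IH] le_m; first by rewrite rot0.
rewrite rotS //=; apply: iff_trans (IH (ltnW le_m)).
by apply: holds_ps; rewrite size_rot.
Qed.

(** Rotating the tail [j] times brings the entry [j] of [s] next to the head, [TI] merges the two,
    and the remaining rotations restore the order. *)
Lemma holds_diag j T s : ar T = (size s).+1 -> j < size s ->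
  holds M (diag (size s) j T) s <-> holds M T (nth d s j :: s).
Proof.
move=> arT ltj; have sE : rot (size s - j) (rot j s) = s.
  by rewrite -rotD subnK ?rot_size // ltnW.
rewrite -{2}sE; apply: iff_trans (holds_iter_p _ _) _.
  by rewrite size_rot leq_subr.
have gt0 : 0 < size s by apply: leq_ltn_trans ltj.
rewrite -(holds_iter_ps _ _ gt0 (ltnW ltj)) /rot (drop_nth d ltj) cat_cons.
by apply: holds_I; rewrite ar_iter // arT.
Qed.

End HoldsClauses.

(* From a term for [T(x_1, ..., x_n, y_1, ..., y_m)] with the tuple stored
   reversed, the term that has the entries of [s] at [idx] for the [y]. *)
Fixpoint subst n T (idx : seq nat) : term :=
  if idx is i :: idx' then subst n (diag (size idx' + n) (size idx' + i) T) idx'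
  else T.

Lemma ar_subst n T idx : 0 < n -> ar T = size idx + n -> ar (subst n T idx) = n.
Proof.
move=> gt0; elim: idx T => //= i idx IH T arT; apply: IH.
by rewrite ar_diag // addn_gt0 gt0 orbT.
Qed.

(** The places are merged from the head on; entry [i] of [s] lies behind the places still left,
    whence the offset [size idx']. *)
Lemma holds_subst M (d : dom M) n T idx s :
  size s = n -> ar T = size idx + n -> all (gtn n) idx ->
  holds M (subst n T idx) s <-> holds M T (map (nth d s) idx ++ s).
Proof.
move=> Es; elim: idx T => //= i idx IH T arT /andP[lti idxP].
have gt0 : 0 < n by apply: leq_ltn_trans lti.
rewrite IH ?ar_diag ?addn_gt0 ?gt0 ?orbT //.
set s' := _ ++ s; have szs' : size s' = size idx + n by rewrite size_cat size_map Es.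
rewrite -szs' (holds_diag d) ?szs' ?ltn_add2l //.
by rewrite nth_cat size_map ltnNge leq_addr /= addKn.
Qed.

(** The universal unary relation, as the negation of a contradiction about an arbitrary symbol. *)
Definition full1 : term := Tneg (TI (TJ (Rel 1 0) (Tneg (Rel 1 0)))).
Definition full n : term := iter n (fun T => TJ T full1) (Tex full1).

Lemma ar_full n : ar (full n) = n.
Proof. by elim: n => // n IH; rewrite -[ar _]/(ar (full n) + 1) IH addn1. Qed.

Lemma holds_full1 M a : holds M full1 [:: a].
Proof.
apply/holds_neg => // /holds_I-/(_ isT) /(holds_J (s := [:: a]) (s' := [:: a])).
by case=> // Ra; apply/holds_neg.
Qed.

Lemma holds_full M s : holds M (full (size s)) s.
Proof.
elim: s => [|a s IH] /=.
  by have [a] := dom_nonempty M; apply/holds_ex => //; exists a; apply: holds_full1.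
rewrite -cat1s; apply/holds_J; rewrite ?ar_full //.
by split=> //; apply: holds_full1.
Qed.

(* The relation symbol with index [i] applied to the variables in [idx]. *)
Definition atom := (nat * seq nat)%type.
(* The number of variables, the body and the head of a Horn clause. *)
Definition clause := (nat * seq atom * atom)%type.

Definition atom_term (a : atom) : term := Rel (size a.2) a.1.

Definition clause_wf (c : clause) : bool :=
  (0 < c.1.1) && all (fun a : atom => all (gtn c.1.1) a.2) (c.2 :: c.1.2).

Definition clause_true A (x0 : A) (J : nat -> seq A -> Prop) (c : clause) : Prop :=
  forall s, size s = c.1.1 ->
  (forall a, a \in c.1.2 -> J a.1 (map (nth x0 s) a.2)) ->
  J c.2.1 (map (nth x0 s) c.2.2).

(** Describes a counterexample to the clause before variables are identified: every argument has its
    own place, and [full n] contributes the places of the variables. *)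
Definition matrix n (body : seq atom) (head : atom) : term :=
  foldr (fun a T => TJ T (atom_term a)) (TJ (full n) (Tneg (atom_term head))) body.

Definition clause_term (c : clause) : term :=
  let: (n, body, head) := c in
  Tneg (iter n Tex (subst n (matrix n body head)
    (flatten (map snd body) ++ head.2))).

Definition theory_term (cs : seq clause) : term :=
  foldr (fun c T => TJ T (clause_term c)) (full 0) cs.

Lemma ar_matrix n body head :
  ar (matrix n body head) = size (flatten (map snd body) ++ head.2) + n.
Proof.
elim: body => [|a body IH] /=; first by rewrite ar_full addnC.
by rewrite IH !size_cat; lia.
Qed.

Lemma ar_clause_term c : clause_wf c -> ar (clause_term c) = 0.
Proof.
case: c => [[n body] head] /andP[/= gt0 _].
by rewrite ar_iter_ex ar_subst ?subnn // ar_matrix.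
Qed.

Lemma ar_theory_term cs : all clause_wf cs -> ar (theory_term cs) = 0.
Proof. by elim: cs => //= c cs IH /andP[/ar_clause_term-> /IH->]. Qed.

Section HoldsTheory.
Variables (M : model) (d : dom M).

(* The interpretation of the symbols that disregards the arities. *)
Definition symbols (i : nat) (s : seq (dom M)) : Prop := holds M (Rel (size s) i) s.

Lemma holds_matrix n body head s : size s = n ->
  holds M (matrix n body head)
    (map (nth d s) (flatten (map snd body) ++ head.2) ++ s) <->
  (forall a, a \in body -> symbols a.1 (map (nth d s) a.2)) /\
  ~ symbols head.1 (map (nth d s) head.2).
Proof.
move=> Es; elim: body => [|a body IH] /=.
  apply: iff_trans (holds_J _ _) _; rewrite ?ar_full ?size_map //.
  rewrite holds_neg ?size_map // /symbols size_map.
  split=> [[_ nh]|[_ nh]]; first by split.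
  by split=> //; rewrite -Es; apply: holds_full.
rewrite -catA map_cat -catA.
apply: iff_trans (holds_J _ _) _; rewrite ?ar_matrix ?size_cat ?size_map ?size_cat ?Es //.
rewrite IH -[holds M (atom_term a) _]/(holds M (Rel (size a.2) a.1) _).
rewrite /symbols; split=> [[[bP hP] aP]|[bP hP]].
  split=> // b; rewrite inE => /predU1P[->|/bP //].
  by rewrite size_map.
split; first by split=> // b b_in; apply: bP; rewrite inE b_in orbT.
by have := bP a; rewrite inE eqxx size_map; apply.
Qed.

Lemma holds_clause c : clause_wf c ->
  holds M (clause_term c) [::] <-> clause_true d symbols c.
Proof.
case: c => [[n body] head] wfc; have := ar_clause_term wfc.
case/andP: wfc => /= gt0 /andP[headP bodyP] ar0.
have idxP : all (gtn n) (flatten (map snd body) ++ head.2).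
  rewrite all_cat headP andbT.
  by elim: (body) bodyP => //= a b IH /andP[aP /IH]; rewrite all_cat aP.
have arS : ar (subst n (matrix n body head) (flatten (map snd body) ++ head.2)) = n.
  by rewrite ar_subst // ar_matrix.
rewrite holds_neg //= holds_iter_ex ?arS // /clause_true /=.
split=> [nE s Es bP|cP [s Es]]; last first.
  rewrite cats0 (holds_subst d) ?ar_matrix // holds_matrix // => -[bP]; apply.
  exact: cP.
apply: NNPP => hP; apply: nE; exists s => //.
by rewrite cats0 (holds_subst d) ?ar_matrix // holds_matrix.
Qed.

Lemma holds_theory cs : all clause_wf cs ->
  holds M (theory_term cs) [::] <-> (forall c, c \in cs -> clause_true d symbols c).
Proof.
elim: cs => [|c cs IH] /=; first by split=> // _; apply: (@holds_full M [::]).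
case/andP=> wfc wfcs; rewrite -[X in holds M _ X]cat0s.
apply: iff_trans (holds_J _ _) _; rewrite ?ar_theory_term ?ar_clause_term //.
rewrite IH // holds_clause //; split=> [[csP cP] c'|csP].
  by rewrite inE => /predU1P[->|/csP].
by split=> [c' c'_in|]; apply: csP; rewrite inE ?eqxx ?c'_in ?orbT.
Qed.

End HoldsTheory.

(** The algebraic form of a quantifier relativised to [U]; it serves to walk along the successor
    relation. *)
Lemma holds_ex_IJ M T U s : ar T = (size s).+1 -> ar U = 1 ->
  holds M (Tex (TI (TJ T U))) s <-> exists2 b, holds M T (b :: s) & holds M U [:: b].
Proof.
move=> arT arU; have E b : holds M (TI (TJ T U)) (b :: s) <->
    holds M T (b :: s) /\ holds M U [:: b].
  apply: iff_trans (holds_I _ _ _) _; first by rewrite /= arT arU addn1.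
  by rewrite -cat1s; apply: holds_J.
rewrite holds_ex /= ?arT ?arU ?addn1 //.
by split=> [[b /E[]]|[b Tb Ub]]; [exists b|exists b; apply/E].
Qed.

(** * Recursive functions as Horn theories *)

(* The symbols 0, 1 and 2 stand for zero, successor and the final predicate;
   the subterm at the position [p] of a code has the symbol [sym p]. The value
   comes first: [1] holds on [i+1, i], and [sym p] on [y :: v] when the
   subterm at [p] maps [v] to [y]. *)
Definition sym (p : seq nat) : nat := (pickle p).+3.

(* In the case of [rec_mu], the symbol of [rcons p 1] holds on [y :: v] when
   the values at all [i < y] are positive. *)
Fixpoint rec_clauses k (c : recfun k) (p : seq nat) : seq clause :=
  let head := sym p in let child i := sym (rcons p i) in
  match c with
  | rec_zero k => [:: (k.+1, [:: (0, [:: 0])], (head, iota 0 k.+1))]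
  | rec_succ => [:: (2, [:: (1, [:: 0; 1])], (head, [:: 0; 1]))]
  | rec_proj k i => [:: (k, [::], (head, val i :: iota 0 k))]
  | rec_comp k m f g =>
      (* Variables: 0 is the value, 1 to k are the arguments, and the last m are the intermediate
         values. *)
      ((k + m).+1,
       (child 0, 0 :: iota k.+1 m) ::
         [seq (child (val i).+1, k.+1 + val i :: iota 1 k) | i : 'I_m],
       (head, iota 0 k.+1)) ::
      rec_clauses f (rcons p 0) ++
      flatten [seq rec_clauses (g i) (rcons p (val i).+1) | i <- enum 'I_m]
  | rec_prim k f g =>
      [:: (k.+2, [:: (0, [:: 1]); (child 0, 0 :: iota 2 k)], (head, iota 0 k.+2)),
          (* Variables: h(i+1), i+1, h(i), i, then the parameters. *)
          (k.+4, [:: (1, [:: 1; 3]); (head, 2 :: 3 :: iota 4 k);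
                      (child 1, 0 :: 3 :: 2 :: iota 4 k)],
           (head, 0 :: 1 :: iota 4 k)) &
          rec_clauses f (rcons p 0) ++ rec_clauses g (rcons p 1)]
  | rec_mu k f =>
      [:: (k.+1, [:: (0, [:: 0])], (child 1, iota 0 k.+1)),
          (* Variables: y+1, y, z+1, z, then the arguments. That the value at y is positive is said
             positively: it is a successor z+1. *)
          (k.+4, [:: (1, [:: 0; 1]); (child 1, 1 :: iota 4 k); (1, [:: 2; 3]);
                      (child 0, 2 :: 1 :: iota 4 k)],
           (child 1, 0 :: iota 4 k)),
          (k.+2, [:: (0, [:: 0]); (child 1, iota 1 k.+1); (child 0, iota 0 k.+2)],
           (head, iota 1 k.+1)) &
          rec_clauses f (rcons p 0)]
  end.

Lemma all_gtn_iota n i k : i + k <= n -> all (gtn n) (iota i k).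
Proof. by move=> le_n; apply/allP=> j; rewrite mem_iota /=; lia. Qed.

Lemma rec_clauses_wf k (c : recfun k) p : all clause_wf (rec_clauses c p).
Proof.
elim: c p => [{}k||{}k i|{}k m f IHf g IHg|{}k f IHf g IHg|{}k f IHf] p;
  rewrite /= ?all_cat ?IHf ?IHg ?andbT /clause_wf /= ?all_gtn_iota //.
- by rewrite ltn_ord /= (leq_ltn_trans _ (ltn_ord i)).
- apply/andP; split=> /=.
    apply/allP=> _ /mapP[i _ ->] /=.
    by rewrite addSn ltnS ltn_add2l ltn_ord all_gtn_iota // ltnS leq_addr.
  by apply/allP=> c /flatten_mapP[i _ c_in]; apply: (allP (IHg i _) _ c_in).
- by rewrite ltnS leq_addr.
Qed.

Lemma map_nth_suffix A (x0 : A) s1 s2 i k : size s1 = i -> size s2 = k ->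
  map (nth x0 (s1 ++ s2)) (iota i k) = s2.
Proof.
move=> <- <-; rewrite map_nth_iota ?size_cat ?addKn // drop_size_cat // take_size //.
Qed.

Arguments map_nth_suffix {A} x0 s1 s2 {i k}.

Lemma map_nth_mid A (x0 : A) s1 s2 s3 i k : size s1 = i -> size s2 = k ->
  map (nth x0 (s1 ++ s2 ++ s3)) (iota i k) = s2.
Proof.
move=> <- <-; rewrite map_nth_iota ?size_cat ?addKn ?leq_addr //.
by rewrite drop_size_cat // take_size_cat.
Qed.

Arguments map_nth_mid {A} x0 s1 s2 {s3 i k}.

(** A universal clause holds in particular of the elements named by numbers; this pulls the theory
    back from an arbitrary model. *)
Lemma clause_true_map A (x0 : A) J (e : nat -> A) c :
  clause_wf c -> clause_true x0 J c -> clause_true 0 (fun i s => J i (map e s)) c.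
Proof.
case: c => [[n body] head] /andP[_ /= /andP[headP /allP bodyP]] cP s /= Es bP.
have mapE idx : all (gtn n) idx -> map (nth x0 (map e s)) idx = map e (map (nth 0 s) idx).
  move=> /allP idxP; rewrite -map_comp; apply/eq_in_map => i /idxP /= lt_i.
  by rewrite (nth_map 0) // Es.
rewrite -mapE //; apply: cP => [|a a_in] /=; first by rewrite size_map.
by rewrite mapE ?bodyP //; apply: bP.
Qed.

Lemma rec_clauses_derive (J : nat -> seq nat -> Prop) k (c : recfun k) p v y :
  J 0 [:: 0] -> (forall n, J 1 [:: n.+1; n]) ->
  {in rec_clauses c p, forall cl, clause_true 0 J cl} ->
  rec_eval c v y -> J (sym p) (y :: v).
Proof.
move=> J0 J1.
elim: c p v y => [{}k||{}k i|{}k m f IHf g IHg|{}k f IHf g IHg|{}k f IHf] p v y /=.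
- move=> /forall_cons[/(_ (0 :: v)) C _] ->; move: C.
  rewrite /= size_tuple (map_nth_suffix 0 [:: 0] v) ?size_tuple //.
  by apply=> // a; rewrite inE => /eqP->.
- move=> /forall_cons[C _] ->; have -> : tval v = [:: thead v] by case: v C => [[|? []]].
  have := C [:: (thead v).+1; thead v]; apply=> // a; rewrite inE => /eqP-> /=; exact: J1.
- move=> /forall_cons[/(_ v) C _] ->; move: C.
  rewrite /= size_tuple (map_nth_suffix 0 [::] v) ?size_tuple //.
  by rewrite (tnth_nth 0); apply.
- move=> /forall_cons[C cP] [w gw fw].
  have {}cP : {in rec_clauses f (rcons p 0), forall cl, clause_true 0 J cl} /\
      forall i, {in rec_clauses (g i) (rcons p (val i).+1), forall cl, clause_true 0 J cl}.
    split=> [|i] cl cl_in; apply: cP; rewrite mem_cat ?cl_in //.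
    apply/orP; right; apply/flatten_mapP; exists i => //; exact: mem_enum.
  have := C (y :: v ++ w); rewrite /= size_cat !size_tuple.
  rewrite (map_nth_mid 0 [:: y] v) ?size_tuple //.
  apply=> // a; rewrite inE => /predU1P[->|/mapP[i _ ->]] /=.
    rewrite (map_nth_suffix 0 (y :: v) w) /= ?size_tuple //.
    exact: IHf cP.1 fw.
  rewrite (map_nth_mid 0 [:: y] v) ?size_tuple //.
  rewrite nth_cat size_tuple ltnNge leq_addr /= addKn -tnth_nth.
  exact: IHg (cP.2 i) (gw i).
- move=> /forall_cons[C1 /forall_cons[C2 cP]] [h [h0 hS ->]].
  have [cPf cPg] : {in rec_clauses f (rcons p 0), forall cl, clause_true 0 J cl} /\
      {in rec_clauses g (rcons p 1), forall cl, clause_true 0 J cl}.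
    by split=> cl cl_in; apply: cP; rewrite mem_cat cl_in ?orbT.
  pose u := [tuple of behead v].
  have -> : tval v = thead v :: u by rewrite {1}(tuple_eta v).
  move: (leqnn (thead v)); elim: {1 3 4}(thead v) => [|i IH] le_in.
    have := C1 [:: h 0, 0 & u]; rewrite /= size_tuple.
    rewrite (map_nth_suffix 0 [:: h 0; 0] u) ?size_tuple //.
    apply=> // a; rewrite !inE => /orP[] /eqP-> //=.
    rewrite (map_nth_suffix 0 [:: h 0; 0] u) ?size_tuple //.
    exact: IHf cPf h0.
  have := C2 [:: h i.+1, i.+1, h i, i & u]; rewrite /= size_tuple.
  rewrite (map_nth_suffix 0 [:: h i.+1; i.+1; h i; i] u) ?size_tuple //.
  apply=> // a; rewrite !inE => /or3P[] /eqP->; rewrite /=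
    ?(map_nth_suffix 0 [:: h i.+1; i.+1; h i; i] u) ?size_tuple //.
    exact: IH (ltnW le_in).
  exact: IHg cPg (hS i le_in).
move=> /forall_cons[C1 /forall_cons[C2 /forall_cons[C3 cP]]] [f0 fS].
have Q i : i <= y -> J (sym (rcons p 1)) (i :: v).
  elim: i => [_|i IH lt_iy].
    have := C1 (0 :: v); rewrite /= size_tuple.
    rewrite (map_nth_suffix 0 [:: 0] v) ?size_tuple //.
    by apply=> // a; rewrite inE => /eqP->.
  have [z fz] := fS i lt_iy.
  have := C2 [:: i.+1, i, z.+1, z & v]; rewrite /= size_tuple.
  rewrite (map_nth_suffix 0 [:: i.+1; i; z.+1; z] v) ?size_tuple //.
  apply=> // a; rewrite !inE => /or4P[] /eqP->; rewrite /=
    ?(map_nth_suffix 0 [:: i.+1; i; z.+1; z] v) ?size_tuple //.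
    exact: IH (ltnW lt_iy).
  exact: (IHf _ _ _ cP fz).
have := C3 [:: 0, y & v]; rewrite /= size_tuple.
rewrite (map_nth_suffix 0 [:: 0; y] v) ?size_tuple //.
apply=> // a; rewrite !inE => /or3P[] /eqP->; rewrite //=
  (map_nth_suffix 0 [:: 0; y] v) ?size_tuple //.
  exact: Q.
exact: (IHf _ _ _ cP f0).
Qed.

(** The standard interpretation of the symbols: the graph of the subterm reached along [p]. Position
    1 below [rec_mu], where no subterm sits, carries the auxiliary predicate of the search. *)
Fixpoint rec_meaning k (c : recfun k) (p : seq nat) (s : seq nat) : Prop :=
  if p is i :: p' then
    match c with
    | rec_comp _ m f g =>
        if i is j.+1 then
          if insub j is Some o then rec_meaning (g o) p' s else False
        else rec_meaning f p' s
    | rec_prim _ f g => if i is 0 then rec_meaning f p' s else rec_meaning g p' s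
    | rec_mu k f =>
        if i is 0 then rec_meaning f p' s
        else exists (v : k.-tuple nat) y, s = y :: v /\
          forall i, i < y -> exists z, rec_eval f [tuple of i :: v] z.+1
    | _ => False
    end
  else exists v y, s = y :: tval v /\ rec_eval c v y.

Lemma rec_meaning_nil k (c : recfun k) y (v : k.-tuple nat) :
  rec_meaning c [::] (y :: v) <-> rec_eval c v y.
Proof.
by case: c v => *; (split=> [[v' [y' [[-> /val_inj ->]]]]|]; [|eexists; eexists; split]).
Qed.

Lemma rec_eval_prim k (f : recfun k) g n (u : k.-tuple nat) y :
  rec_eval (rec_prim f g) [tuple of n :: u] y <->
  exists h, [/\ rec_eval f u (h 0),
    forall i, i < n -> rec_eval g [tuple of i :: h i :: u] (h i.+1) & y = h n].
Proof.
have eval_val l (c : recfun l) (v w : l.-tuple nat) z :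
    tval v = w -> rec_eval c v z -> rec_eval c w z by move/val_inj->.
rewrite /= theadE; split=> -[h [h0 hS Ey]]; exists h.
  by split=> // [|i lt_in]; [apply: eval_val h0|apply: eval_val (hS i lt_in)].
by split=> // [|i lt_in]; [apply: eval_val h0|apply: eval_val (hS i lt_in)].
Qed.

Lemma tuple_of_size (T : Type) k (s : seq T) : size s = k -> exists v : k.-tuple T, s = v.
Proof. by move=> /eqP Es; exists (Tuple Es). Qed.

(** The hypothesis ranges over all relative positions [q] so that it passes to subterms:
    [rcons p i ++ q] is [p ++ i :: q], and [rec_meaning] strips the [i]. *)
Lemma rec_clauses_true (J : nat -> seq nat -> Prop) k (c : recfun k) p :
  (forall s, J 0 s -> s = [:: 0]) ->
  (forall s, J 1 s -> exists n, s = [:: n.+1; n]) ->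
  (forall q s, J (sym (p ++ q)) s <-> rec_meaning c q s) ->
  {in rec_clauses c p, forall cl, clause_true 0 J cl}.
Proof.
move=> J0 J1.
have Jhead l (c' : recfun l) q (v : l.-tuple nat) y :
    (forall r s, J (sym (q ++ r)) s <-> rec_meaning c' r s) ->
    J (sym q) (y :: v) <-> rec_eval c' v y.
  by move=> JP; rewrite -{1}(cats0 q) JP rec_meaning_nil.
elim: c p => [{}k||{}k i|{}k m f IHf g IHg|{}k f IHf g IHg|{}k f IHf] p JP /=.
- apply/forall_cons; split=> // s /=; case: s => //= z s [/tuple_of_size[v ->]] {s} bP.
  have [->] := J0 _ (bP _ (mem_head _ _)).
  by rewrite (map_nth_suffix 0 [:: 0] v) ?size_tuple //; apply/(Jhead _ _ _ _ _ JP).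
- apply/forall_cons; split=> // s /=; case: s => [|y [|x []]] //= _ bP.
  have [n [-> ->]] := J1 _ (bP _ (mem_head _ _)).
  exact/(Jhead _ _ _ [tuple n] _ JP).
- apply/forall_cons; split=> // s /= /tuple_of_size[v ->] {s} _.
  rewrite (map_nth_suffix 0 [::] v) ?size_tuple // -tnth_nth.
  exact/(Jhead _ _ _ _ _ JP).
- have JPf q s : J (sym (rcons p 0 ++ q)) s <-> rec_meaning f q s.
    by rewrite cat_rcons JP.
  have JPg (i : 'I_m) q s : J (sym (rcons p (val i).+1 ++ q)) s <-> rec_meaning (g i) q s.
    by rewrite cat_rcons JP /= valK.
  apply/forall_cons; split=> [s|cl]; last first.
    rewrite mem_cat => /orP[|/flatten_mapP[i _]]; first exact: IHf JPf _.
    exact: IHg (JPg i) _.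
  case: s => //= y s [Es] bP.
  have [v Ev] : exists v : k.-tuple nat, take k s = v.
    by apply: tuple_of_size; rewrite size_takel // Es leq_addr.
  have [w Ew] : exists w : m.-tuple nat, drop k s = w.
    by apply: tuple_of_size; rewrite size_drop Es addKn.
  move: bP; rewrite -(cat_take_drop k s) {}Ev {}Ew {Es s} => bP.
  rewrite (map_nth_mid 0 [:: y] v) ?size_tuple //; apply/(Jhead _ _ _ _ _ JP).
  exists w => [i|].
    apply/(Jhead _ _ _ _ _ (JPg i)).
    have := bP (sym (rcons p i.+1), k.+1 + i :: iota 1 k).
    rewrite inE map_f ?mem_enum ?orbT //= (map_nth_mid 0 [:: y] v) ?size_tuple //.
    by rewrite nth_cat size_tuple ltnNge leq_addr /= addKn -tnth_nth; apply.
  apply/(Jhead _ _ _ _ _ JPf); have := bP _ (mem_head _ _).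
  by rewrite /= (map_nth_suffix 0 (y :: v) w) /= ?size_tuple.
- have JPf q s : J (sym (rcons p 0 ++ q)) s <-> rec_meaning f q s.
    by rewrite cat_rcons JP.
  have JPg q s : J (sym (rcons p 1 ++ q)) s <-> rec_meaning g q s.
    by rewrite cat_rcons JP.
  apply/forall_cons; split=> [s|].
    case: s => [|y [|n s]] //= [/tuple_of_size[u ->]] {s}.
    move=> /forall_cons[/J0[->]] /forall_cons[].
    rewrite /= !(map_nth_suffix 0 [:: y; 0] u) ?size_tuple // => /(Jhead _ _ _ _ _ JPf) fy _.
    by apply/(Jhead _ _ _ [tuple of 0 :: u] _ JP)/rec_eval_prim; exists (fun=> y).
  apply/forall_cons; split=> [s|cl]; last first.
    by rewrite mem_cat => /orP[]; [exact: IHf JPf _|exact: IHg JPg _].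
  case: s => [|y' [|n' [|y [|n s]]]] //= [/tuple_of_size[u ->]] {s}.
  move=> /forall_cons[/J1[_ [-> <-]]] /forall_cons[+ /forall_cons[+ _]].
  rewrite /= !(map_nth_suffix 0 [:: y'; n.+1; y; n] u) ?size_tuple //.
  move=> /(Jhead _ _ _ [tuple of n :: u] _ JP)/rec_eval_prim[h [h0 hS ->]].
  move=> /(Jhead _ _ _ [tuple of n :: h n :: u] _ JPg) gn.
  apply/(Jhead _ _ _ [tuple of n.+1 :: u] _ JP)/rec_eval_prim.
  (* The sequence of values up to [n] is prolonged by [y'] at n+1. *)
  exists (fun i => if i <= n then h i else y'); rewrite ltnn; split=> // i.
  rewrite ltnS; case: ltngtP => // [lt_in _|-> _ //].
  exact: hS.
have JPf q s : J (sym (rcons p 0 ++ q)) s <-> rec_meaning f q s.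
  by rewrite cat_rcons JP.
have JQ s : J (sym (rcons p 1)) s <-> rec_meaning (rec_mu f) [:: 1] s.
  by rewrite -cats1 JP.
apply/forall_cons; split=> [s|].
  case: s => //= y s [/tuple_of_size[v ->]] {s} /forall_cons[/J0[->] _].
  rewrite (map_nth_suffix 0 [:: 0] v) ?size_tuple //.
  by apply/JQ; exists v, 0.
apply/forall_cons; split=> [s|].
  case: s => [|y' [|y [|r [|z s]]]] //= [/tuple_of_size[v ->]] {s}.
  move=> /forall_cons[/J1[_ [-> <-]]] /forall_cons[+ /forall_cons[+ /forall_cons[+ _]]].
  rewrite /= !(map_nth_suffix 0 [:: y.+1; y; r; z] v) ?size_tuple //.
  move=> /JQ[v' [_ [[<- /val_inj <-] Qy]]] /J1[_ [-> <-]].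
  move=> /(Jhead _ _ _ [tuple of y :: v] _ JPf) fz.
  apply/JQ; exists v, y.+1; split=> // i.
  rewrite ltnS leq_eqVlt => /predU1P[->|]; last exact: Qy.
  by exists z.
apply/forall_cons; split=> [s|cl]; last exact: IHf JPf _.
case: s => [|z [|y s]] //= [/tuple_of_size[v ->]] {s}.
move=> /forall_cons[/J0[->]] /forall_cons[+ /forall_cons[+ _]].
rewrite /= !(map_nth_suffix 0 [:: 0; y] v) ?size_tuple //.
move=> /JQ[v' [_ [[<- /val_inj <-] Qy]]] /(Jhead _ _ _ [tuple of y :: v] _ JPf) fy.
by apply/(Jhead _ _ _ _ _ JP).
Qed.

(** * The reduction *)

Section Reduction.
Variable c : recfun 2.

(* The last predicate holds on [x] when [c] maps some [x, y] to [0]. *)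
Definition zero_clauses : seq clause :=
  (3, [:: (0, [:: 0]); (sym [::], [:: 0; 1; 2])], (2, [:: 1])) :: rec_clauses c [::].

(** The last two conjuncts, a zero exists and every element has a successor, give every number a
    name in any model. *)
Definition axioms : term :=
  TJ (theory_term zero_clauses)
     (TJ (Tex (Rel 1 0)) (Tneg (Tex (Tneg (Tex (Rel 2 1)))))).

(** With no constants available, a number is written in unary: some chain of [n] successors leads to
    an element of the final predicate. *)
Definition shifted_zero (n : nat) : term :=
  iter n (fun T => Tex (TI (TJ (Rel 2 1) T))) (Rel 1 2).

Definition no_zero_term (x : nat) : term :=
  TJ axioms (Tneg (Tex (TI (TJ (Rel 1 0) (shifted_zero x))))).

Lemma zero_clauses_wf : all clause_wf zero_clauses.
Proof. by rewrite /= rec_clauses_wf. Qed.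

Lemma ar_shifted_zero n : ar (shifted_zero n) = 1.
Proof. by elim: n => //= n ->. Qed.

Lemma ar_axioms : ar axioms = 0.
Proof.
rewrite -[LHS]/(ar (theory_term zero_clauses) + 0) ar_theory_term //.
exact: zero_clauses_wf.
Qed.

Lemma ar_no_zero_term x : ar (no_zero_term x) = 0.
Proof.
by rewrite -[LHS]/(ar axioms + (arI (1 + ar (shifted_zero x))).-1)
  ar_axioms ar_shifted_zero.
Qed.

Lemma holds_no_zero_term M x : holds M (no_zero_term x) [::] <->
  [/\ holds M (theory_term zero_clauses) [::],
      exists a, holds M (Rel 1 0) [:: a],
      forall a, exists b, holds M (Rel 2 1) [:: b; a] &
      ~ exists2 a, holds M (Rel 1 0) [:: a] & holds M (shifted_zero x) [:: a]].
Proof.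
have arT := ar_theory_term zero_clauses_wf.
have J0 T U : ar T = 0 -> ar U = 0 ->
    holds M (TJ T U) [::] <-> holds M T [::] /\ holds M U [::].
  by move=> T0 U0; rewrite -[X in holds M (TJ T U) X]cat0s; apply: holds_J.
have arN : ar (Tneg (Tex (TI (TJ (Rel 1 0) (shifted_zero x))))) = 0.
  by rewrite /= ar_shifted_zero.
rewrite /no_zero_term J0 ?ar_axioms // /axioms !J0 //.
rewrite holds_ex // !holds_neg ?holds_ex_IJ ?holds_ex //= ?ar_shifted_zero //.
split=> [[[TP [ZP SP]] NP]|[TP ZP SP NP]]; split=> //.
  move=> a; apply: NNPP => nE; apply: SP; exists a; apply/holds_neg => // /holds_ex -/(_ isT).
  exact: nE.
split=> //; split=> // -[a /holds_neg-/(_ erefl)]; apply; apply/holds_ex => //.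
Qed.

Lemma no_zero_term_sound x y :
  satisfiable (no_zero_term x) -> ~ rec_eval c [tuple of [:: x; y]] 0.
Proof.
case/satisfiableP=> M [s /[dup] /holds_size].
rewrite ar_no_zero_term => /size0nil -> /holds_no_zero_term[TP [a0 Za] SP NP] cxy.
have [next nextP] : exists f, forall a, holds M (Rel 2 1) [:: f a; a].
  exact: (choice _ SP).
(* The elements named by the numbers: a chosen zero and its chosen iterated successors. *)
pose e n := iter n next a0.
have clP cl : cl \in zero_clauses -> clause_true 0 (fun i s => symbols i (map e s)) cl.
  move=> cl_in; apply: (clause_true_map (x0 := a0)).
    exact: allP zero_clauses_wf _ cl_in.
  exact: (holds_theory a0 zero_clauses_wf).1.
have Bx : holds M (Rel 1 2) [:: e x].
  have := clP _ (mem_head _ _) [:: 0; x; y]; apply=> // a.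
  rewrite !inE => /orP[] /eqP-> //=.
  apply: (rec_clauses_derive (J := fun i s => symbols i (map e s)) (p := [::])) cxy => // [n|].
    exact: nextP.
  by move=> cl cl_in; apply: clP; rewrite inE cl_in orbT.
apply: NP; exists a0 => //; rewrite -[a0]/(e 0).
have: x + 0 = x by rewrite addn0.
(* Invariant n + m = x: from [e m], [n] steps remain to [e x]. *)
move: 0 {1 3}x => m n; elim: n m => [|n IH] m; first by rewrite add0n => ->.
rewrite addSnnS => /IH Bn; apply/holds_ex_IJ; rewrite ?ar_shifted_zero //.
by exists (e m.+1) => //; apply: nextP.
Qed.

Definition zero_meaning (i : nat) (s : seq nat) : Prop :=
  match i with
  | 0 => s = [:: 0]
  | 1 => exists n, s = [:: n.+1; n]
  | 2 => exists x y, s = [:: x] /\ rec_eval c [tuple of [:: x; y]] 0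
  | j.+3 => if unpickle j is Some p then rec_meaning c p s else False
  end.

Lemma zero_meaning_sym p s : zero_meaning (sym p) s = rec_meaning c p s.
Proof. by rewrite /zero_meaning /sym pickleK. Qed.

Definition zero_model : model :=
  @Model nat (inhabits 0) (fun k i t => zero_meaning i (rev t)).

Lemma holds_zero_model i (s : seq nat) k : size s = k ->
  holds zero_model (Rel k i) s <-> zero_meaning i s.
Proof.
move=> Es; split=> [[t Rt Et]|Rs]; first by rewrite -(revK s) -Et.
have szs : size (rev s) == k by rewrite size_rev Es.
by exists (Tuple szs); rewrite //= revK.
Qed.

Lemma no_zero_term_complete x :
  (forall y, ~ rec_eval c [tuple of [:: x; y]] 0) -> satisfiable (no_zero_term x).
Proof.
move=> nz; apply/satisfiableP; exists zero_model, [::]; apply/holds_no_zero_term.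
split=> [|||[a /holds_zero_model-/(_ erefl) [->]]].
- apply/(holds_theory (0 : dom zero_model) zero_clauses_wf) => cl cl_in.
  suff: clause_true 0 zero_meaning cl.
    move=> clP s Es bP; apply/holds_zero_model => //; apply: clP => // a /bP.
    by move/holds_zero_model; apply.
  move: cl cl_in; apply/forall_cons; split=> [s|].
    case: s => [|z [|x' [|y []]]] // _ /forall_cons[[->] /forall_cons[+ _]].
    rewrite [zero_meaning _ _]zero_meaning_sym.
    by move/(rec_meaning_nil c 0 [tuple x'; y]) => cxy; exists x', y.
  by apply: rec_clauses_true => // q s; rewrite zero_meaning_sym.
- by exists 0; apply/holds_zero_model.
- by move=> a; exists a.+1; apply/holds_zero_model => //; exists a.
(* Successors are unique in the standard model, so a chain of [n] steps from [m] can only end at m +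
   n. *)
have H n m : holds zero_model (shifted_zero n) [:: m] -> zero_meaning 2 [:: m + n].
  elim: n m => [|n IH] m /=; first by rewrite addn0; apply: (holds_zero_model _ _).1.
  case/holds_ex_IJ=> //; first exact: ar_shifted_zero.
  move=> b /holds_zero_model-/(_ erefl) [_ [-> <-]] /IH; by rewrite addSnnS.
by case/H=> x' [y [[<-] /nz]].
Qed.

End Reduction.

Lemma sat_problem_code T : sat_problem (code T) <-> satisfiable T.
Proof. by split=> [[T' /code_inj->]|]; last by exists T. Qed.

(** Only the successor chain varies with [x], and its code is an iteration; the code of the axioms
    is a constant. *)
Lemma crec_code_no_zero_term c : crec (fun x => code (no_zero_term c x)).
Proof.
have shiftP : crec (fun x => code (shifted_zero x)).
  apply: (crec_ext (f := fun x => iter x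
    (fun u => npair 6 (npair 3 (npair 5 (npair (code (Rel 2 1)) u)))) (code (Rel 1 2)))).
    by elim=> //= n ->.
  by apply: crec_iter; crec_auto.
rewrite /no_zero_term /= -/code.
by move: (code (axioms c)) => n; do ?[exact: shiftP | progress crec_auto].
Qed.

Lemma sat_problem_Pi01_hard Y : Pi01 Y -> many_one_reducible Y sat_problem.
Proof.
case=> R [c cP] YP; exists (fun x => code (no_zero_term c x)).
  apply: total_recursive_ext (crec_code_no_zero_term c) => v.
  by rewrite /thead (tnth_nth 0).
(* The value 0 means false, so the absence of a zero says that no [y] refutes [R x y]. *)
have RP x y : rec_eval c [tuple of [:: x; y]] 0 <-> ~~ R x y.
  by rewrite cP !(tnth_nth 0) /=; case: (R x y).
move=> x; rewrite YP sat_problem_code; split=> [Rx|sat_x y].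
  by apply: no_zero_term_complete => y /RP; rewrite Rx.
by apply: contraT => /RP cxy; case: (no_zero_term_sound sat_x cxy).
Qed.

Theorem proposition6p1 : Pi01_complete sat_problem.
Proof. by split; [exact: sat_problem_Pi01|exact: sat_problem_Pi01_hard]. Qed.
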